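(* Let $k\in\mathbb{C}$. Let $L$ be an integral lattice with nondegenerate bilinear form $(\cdot|\cdot)$, let $\mathfrak{h}=\mathbb{C}\otimes_{\mathbb{Z}}L$, let $\delta\in L$ with $|\delta|^2=0$, and let $\alpha,\beta,\gamma\in\mathfrak{h}$ be such that $\mathfrak{h}=\mathrm{span}_{\mathbb{C}}\{\alpha,\beta,\gamma,\delta\}$. In the lattice vertex algebra $V_L$ consider the fields $$e(z)={:}\alpha(z)e^{\delta}(z){:},\qquad h(z)=\beta(z),\qquad f(z)={:}\gamma(z)e^{-\delta}(z){:}.$$ Up to the rescaling $e\mapsto\lambda e$, $f\mapsto\lambda^{-1}f$, $h\mapsto h$ with $\lambda\in\mathbb{C}\setminus\{0\}$ (equivalently, up to replacing $(\alpha,\gamma)$ by $(\lambda\alpha,\lambda^{-1}\gamma)$), these formulas provide an embedding of $\widehat{\mathfrak{sl}}_2$ of level $k$ in $V_L$ if and only if $$\beta=k\delta+\alpha-\gamma,\quad |\delta|^2=0,\quad (\alpha|\gamma)=k+1,\quad |\alpha|^2=|\gamma|^2=(\delta|\alpha)=-(\delta|\gamma)=1.$$ That is, the fields $e(z),h(z),f(z)$ provide an embedding of $\widehat{\mathfrak{sl}}_2$ of level $k$ if and only if there is $\lambda\in\mathbb{C}\setminus\{0\}$ such that the displayed conditions hold with $(\alpha,\gamma)$ replaced by $(\lambda\alpha,\lambda^{-1}\gamma)$.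
   Context: $V_L$ is the lattice vertex (super)algebra of $L$. For $a\in\mathfrak{h}$, $a(z)=\sum_{n\in\mathbb{Z}}a_{(n)}z^{-n-1}$ is the Heisenberg field, with $[a_{(m)},b_{(n)}]=m\delta_{m,-n}(a|b)$; $e^{\pm\delta}(z)$ are the vertex operators of $e^{\pm\delta}\in V_L$, so that $[a_{(m)},e^{\pm\delta}(z)]=\pm(a|\delta)z^m e^{\pm\delta}(z)$. The 2-cocycle is normalized so that $e^{\delta}_{(-1)}e^{-\delta}=\mathbf{1}$. We write $|a|^2=(a|a)$, and ${:}\ {:}$ is normal ordering; thus $e(z),f(z),h(z)$ are the fields of the vectors $\alpha_{(-1)}e^{\delta}$, $\gamma_{(-1)}e^{-\delta}$, $\beta_{(-1)}\mathbf{1}$. The fields $e(z),h(z),f(z)$ ''provide an embedding of $\widehat{\mathfrak{sl}}_2$ of level $k$ in $V_L$'' when they satisfy the operator product expansions (OPEs; $\sim$ means equality modulo terms regular at $z=w$) $$e(z)f(w)\sim\frac{h(w)}{z-w}+\frac{k}{(z-w)^2},\quad h(z)h(w)\sim\frac{2k}{(z-w)^2},\quad h(z)e(w)\sim\frac{2e(w)}{z-w},$$ $$h(z)f(w)\sim\frac{-2f(w)}{z-w},\quad e(z)e(w)\sim0,\quad f(z)f(w)\sim0,$$ i.e. when their modes satisfy $[a_{(m)},b_{(n)}]=[a,b]_{(m+n)}+m\delta_{m,-n}\mathrm{tr}(ab)k$ for $a,b\in\mathfrak{sl}_2$ and $m,n\in\mathbb{Z}$, where $e,f,h$ is the standard basis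 of $\mathfrak{sl}_2$.
   Formalization: The lattice L is assumed to be nonzero: for L = 0 and k = 0 all three fields vanish and the operator product expansions hold trivially, while the condition (δ|α) = 1 fails, so the equivalence is false there. *)

(* Defs.v *)
From mathcomp Require Import all_boot all_order all_algebra.
From mathcomp Require Import finmap monalg complex.
From mathcomp Require Import boolp classical_sets fsbigop reals.

Set Implicit Arguments.
Unset Strict Implicit.
Unset Printing Implicit Defensive.

Import GRing.Theory.

Local Open Scope ring_scope.

Section Lattice.
Variables (F : fieldType) (r : nat) (G : 'M[int]_r).

(* The integral lattice is Z^r with Gram matrix G; it sits in h = F (x) Z^r,
   which carries the F-bilinear extension of the form. *)
Definition latform (x y : 'rV[int]_r) : int := (x *m G *m y^T) 0 0.

Definition hform (a b : 'rV[F]_r) : F := (a *m map_mx intr G *m b^T) 0 0.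

Definition inh (x : 'rV[int]_r) : 'rV[F]_r := map_mx intr x.

(* The zero lattice is excluded: over it every field below vanishes, and the
   relations of the affine algebra hold trivially at level 0. *)
Definition integral_lattice : Prop :=
  [/\ (0 < r)%N,
      forall x y, latform x y = latform y x &
      forall x, (forall y, latform x y = 0) -> x = 0].

(* The commutator condition is the one of the vertex superalgebra: e^x has
   parity (x|x) mod 2. *)
Definition lattice_cocycle (eps : 'rV[int]_r -> 'rV[int]_r -> F) : Prop :=
  [/\ forall x y, eps x y != 0,
      forall x, eps x 0 = 1 /\ eps 0 x = 1,
      forall x y z, eps x y * eps (x + y) z = eps x (y + z) * eps y z &
      forall x y, eps x y =
        (-1) ^ (latform x y + latform x x * latform y y) * eps y x].

End Lattice.

Section LatticeVertexAlgebra.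
Variables (F : fieldType) (r : nat) (G : 'M[int]_r).
Variable eps : 'rV[int]_r -> 'rV[int]_r -> F.

(* V_L = F_eps[L] (x) Sym(t^-1 h[t^-1]).  The basis vector (x, m) is
   e^x (x) prod_(i, n) (b_i t^-(n+1))^(m (i, n)), where b_i is the i-th
   standard basis vector of Z^r. *)
Definition VLbasis : choiceType := ('rV[int]_r * {cmonom ('I_r * nat)})%type.

Definition VL := {malg F[VLbasis]}.

Definition expvec (x : 'rV[int]_r) : VL := << ((x, onecm _) : VLbasis) >>.

Definition vacuum : VL := expvec 0.

Definition linext (g : VLbasis -> VL) (v : VL) : VL :=
  \sum_(b <- msupp v) v@_b *: g b.

(* A formal distribution is given by its modes:
   A(z) = sum_n (A n) z^(-n-1). *)
Definition distribution := int -> VL -> VL.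

(* a_(-n-1) multiplies by a t^-(n+1), a_(0) acts on e^x by (a|x), and
   a_(n+1) is (n+1) sum_i (a|b_i) d/d(b_i t^-(n+1)). *)
Definition heis (a : 'rV[F]_r) : distribution := fun m => linext (fun b =>
  match m with
  | Negz n => \sum_(i < r) a 0 i *: << ((b.1, mulcm b.2 (ucm (i, n))) : VLbasis) >>
  | Posz 0 => hform G a (inh F b.1) *: << b >>
  | Posz n.+1 => \sum_(i < r)
      (n.+1%:R * hform G a (delta_mx 0 i) * (b.2 (i, n))%:R)
        *: << ((b.1, divcm b.2 (ucm (i, n))) : VLbasis) >>
  end).

(* Formal power series with operator coefficients. *)
Definition opseries := nat -> VL -> VL.

Definition opseries1 : opseries := fun l v => if l is 0%N then v else 0.

Definition opseries_mul (A B : opseries) : opseries :=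
  fun l v => \sum_(i < l.+1) A i (B (l - i)%N v).

(* Truncating the exponential sum at l is exact when A has no constant term. *)
Definition opseries_exp (A : opseries) : opseries := fun l v =>
  \sum_(m < l.+1) (m`!%:R)^-1 *: iter m (opseries_mul A) opseries1 l v.

(* exp (sum_(n > 0) x_(-n) z^n / n), as a series in z *)
Definition exp_creation (x : 'rV[int]_r) : opseries :=
  opseries_exp (fun n v =>
    if n is 0%N then 0 else n%:R^-1 *: heis (inh F x) (- n%:Z) v).

(* exp (- sum_(n > 0) x_(n) z^-n / n), as a series in z^-1 *)
Definition exp_annihilation (x : 'rV[int]_r) : opseries :=
  opseries_exp (fun n v =>
    if n is 0%N then 0 else - n%:R^-1 *: heis (inh F x) n%:Z v).

Definition shift (x : 'rV[int]_r) : VL -> VL := linext (fun b =>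
  eps x b.1 *: << ((x + b.1, b.2) : VLbasis) >>).

(* e^x(z) = e^x z^(x_(0)) exp (sum_(n > 0) x_(-n) z^n / n)
                          exp (- sum_(n > 0) x_(n) z^-n / n).
   The coefficient of z^(-n-1) collects the terms z^j z^-l z^(x|y) on the
   component of degree y; the sum over l has finite support because
   annihilation operators lower the conformal weight. *)
Definition expfield (x : 'rV[int]_r) : distribution := fun n =>
  linext (fun b => \sum_(l \in [set: nat])
    if (l%:Z - n - 1 - latform G x b.1)%R is Posz j
    then exp_creation x j (shift x (exp_annihilation x l << b >>))
    else 0).

(* Normally ordered product of fields, the first of which is even; both sums
   have finite support when A and B are fields. *)
Definition normal_product (A B : distribution) : distribution := fun n v =>
  \sum_(j \in [set: nat]) A (- j%:Z - 1) (B (n + j%:Z) v)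
  + \sum_(j \in [set: nat]) B (n - j%:Z - 1) (A j%:Z v).

Definition sl2_distribution (e h f : distribution) (a : 'M[F]_2) :
    distribution := fun n v =>
  a 0 1 *: e n v + a 0 0 *: h n v + a 1 0 *: f n v.

(* The six operator product expansions, as commutators of modes:
   [a_(m), b_(n)] = [a, b]_(m+n) + m delta_(m,-n) tr(ab) k.
   The bracket is the plain commutator: this is only applied to even fields. *)
Definition affine_sl2_embedding (k : F) (e h f : distribution) : Prop :=
  forall a b : 'M[F]_2, \tr a = 0 -> \tr b = 0 ->
  forall (m n : int) (v : VL),
    let X := sl2_distribution e h f in
    X a m (X b n v) - X b n (X a m v) =
    X (a *m b - b *m a) (m + n) v
    + (m%:~R * (m == - n)%:R * \tr (a *m b) * k) *: v.

End LatticeVertexAlgebra.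

(* Main.v *)
Require Import Defs.
From HB Require Import structures.
From mathcomp Require Import all_boot all_order all_algebra.
From mathcomp Require Import finmap monalg complex.
From mathcomp Require Import boolp classical_sets fsbigop reals.
From mathcomp Require Import zify ring.

Set Implicit Arguments.
Unset Strict Implicit.
Unset Printing Implicit Defensive.

Import Order.TTheory GRing.Theory Num.Theory.

Local Open Scope ring_scope.

(* Write E^x(z) for e^x(z) with x in {delta, - delta}.  As (delta|delta) = 0,
   these fields commute, E^x(z) E^y(z) = eps(x, y) E^(x+y)(z), the derivative of
   E^x(z) is :x(z) E^x(z):, and [a_(m), E^x(z)] = (a|x) z^m E^x(z).  Hence for
   e(z) = :a(z) E^x(z): and f(z) = :c(z) E^y(z):, with N = m + n and
   kappa = (a|c) - (a|y) (c|x),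
     [e_(m), f_(n)] = eps(x, y) ((a|y) :c E^(x+y):_(N) - (c|x) :a E^(x+y):_(N)
                        - kappa (:y E^(x+y):_(N) + n E^(x+y)_(N-1))).
   For a = alpha, c = gamma and (x, y) = (delta, - delta) this is the mode of
   kappa delta - (c|delta) a - (a|delta) c, plus the central term m kappa; for
   x = y and a = c it vanishes if (a|a) = (a|x)^2.  The relations of affine sl2
   thus read: beta is that vector, kappa = k, (beta|delta) = 2, and beta is
   orthogonal to a and c.  These are equivalent to the displayed equations, with
   lambda = (alpha|delta)^-1.

   The commutators are computed on an abstract vector space carrying Heisenberg
   modes a_(n), shifts S_x and the coefficients P, Q of the two exponentials.  A
   sum that is infinite but locally finite is replaced by its partial sums with
   at least K0 terms, where K0 depends on the vector. *)

(** The obstacle is convergence. A product of two fields at one point is a sum over all integers s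
    of terms E^x_(m+s) E^y_(n-1-s), and it is finite on a given vector only because the two fields
    commute: for large s the factor E^x is applied first and kills the vector, for very negative s
    the factor E^y is. Hence each partial sum adds one term of either half, and in [E_fusion] and
    [cur_fin] the bounds involve K + n, so that one K0 serves all modes of a nested sum. Commuting
    :a E^x: past :c E^y: leaves, besides such products, a sum weighted by s + 1. It comes from the
    double pole of a with c and again from the product of the two simple contractions (a|y) and
    (c|x), which is why kappa combines these numbers. In the necessity direction the relations also
    hold for e = h = f = 0 at level 0. There alpha = beta = gamma = 0, so the isotropic vector delta
    would span the whole space, against nondegeneracy in positive rank. *)

(* Locked, as are the operators below: unifying two concrete vectors of V_L
   would otherwise unfold the finitely supported functions representing them. *)
HB.lock Definition bvec (F : fieldType) (r : nat) (b : VLbasis r) : VL F r :=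
  << b >>.

(** * Linear extension from the monomial basis *)

Section LinearExtension.
Variables (F : fieldType) (r : nat).
Local Notation V := (VL F r).
Local Notation basis := (VLbasis r).
Local Notation bvec := (@bvec F r).

(** Linearity compares the expansions of several vectors, which requires a support common to all of
    them. *)
Lemma linextEw (g : basis -> V) (v : V) (D : {fset basis}) :
  (msupp v `<=` D)%fset -> linext g v = \sum_(b <- D) v@_b *: g b.
Proof.
move=> sD; apply: big_fset_incl => // b _ bv.
by rewrite mcoeff_outdom ?scale0r.
Qed.

Fact linext_is_linear (g : basis -> V) : linear (linext g).
Proof.
move=> a u v; pose D := (msupp u `|` msupp v)%fset.
rewrite (@linextEw g u D) ?fsubsetUl // (@linextEw g v D) ?fsubsetUr //.
rewrite (@linextEw g _ D); last first.
  by apply: fsubset_trans (msuppD_le _ _) _; apply: fsetSU; exact: msuppZ_le.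
rewrite scaler_sumr -big_split; apply: eq_bigr => b _ /=.
by rewrite mcoeffD mcoeffZ scalerDl scalerA.
Qed.

HB.instance Definition _ g :=
  GRing.isLinear.Build F (VL F r) (VL F r) *:%R (linext g) (linext_is_linear g).

Lemma linextU (g : basis -> V) b : linext g (bvec b) = g b.
Proof.
rewrite unlock.
rewrite (@linextEw _ _ [fset b]%fset) ?msuppU_le // big_seq_fset1.
by rewrite mcoeffUU scale1r.
Qed.

Lemma VL_decomposition (v : V) : v = \sum_(b <- msupp v) v@_b *: bvec b.
Proof.
rewrite {1}(monalgE v); apply: eq_bigr => b _; rewrite bvec.unlock.
move: v@_b => c; apply/malgP => b'.
rewrite mcoeffZ [LHS]mcoeffU [X in _ * X]mcoeffU.
by rewrite mulrnAr mulr1.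
Qed.

Lemma VL_ind (P : V -> Prop) :
  (forall b : basis, P (bvec b)) ->
  (forall a u v, P u -> P v -> P (a *: u + v)) -> forall v, P v.
Proof.
(* Closure under 0 comes from -1 times a basis vector plus the same vector. *)
move=> Pb PD v; have P0 : P 0.
  have := PD (-1) _ _ (Pb (0, onecm _)) (Pb (0, onecm _)).
  by rewrite scaleN1r addNr.
rewrite (VL_decomposition v); elim: (enum_fset _) => [|b s IH].
  by rewrite big_nil.
by rewrite big_cons; exact: PD.
Qed.

End LinearExtension.

(** * Multiplication and differentiation by a variable *)

HB.lock Definition mulvar (F : fieldType) (r : nat) (q : 'I_r * nat) :
    VL F r -> VL F r :=
  linext (fun b => << ((b.1, mulcm b.2 (ucm q)) : VLbasis r) >>).

HB.lock Definition dervar (F : fieldType) (r : nat) (q : 'I_r * nat) :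
    VL F r -> VL F r :=
  linext (fun b =>
    (b.2 q)%:R *: << ((b.1, divcm b.2 (ucm q)) : VLbasis r) >>).

Section ConomialArithmetic.
Variable I : choiceType.
Implicit Types (m : cmonom I) (p q : I).

Lemma divcmAC m p q :
  divcm (divcm m (ucm p)) (ucm q) = divcm (divcm m (ucm q)) (ucm p).
Proof. by apply/eqP/cmP => i; rewrite !divcmE subnAC. Qed.

Lemma mulcmK m p : divcm (mulcm m (ucm p)) (ucm p) = m.
Proof. by apply/eqP/cmP => i; rewrite divcmE mulcmE addnK. Qed.

Lemma divcmK m p : m p != 0%N -> mulcm (divcm m (ucm p)) (ucm p) = m.
Proof.
move=> mp; apply/eqP/cmP => i; rewrite mulcmE divcmE ucmE subnK //.
by case: eqP => // <-; rewrite lt0n.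
Qed.

Lemma divcm_mul m p q : p != q -> m p != 0%N ->
  divcm (mulcm m (ucm q)) (ucm p) = mulcm (divcm m (ucm p)) (ucm q).
Proof.
move=> npq mp; apply/eqP/cmP => i; rewrite divcmE !mulcmE divcmE !ucmE.
by rewrite addnBAC //; case: eqP => // <-; rewrite lt0n.
Qed.

End ConomialArithmetic.

Section Heisenberg.
Variables (F : fieldType) (r : nat) (G : 'M[int]_r).
Local Notation V := (VL F r).
Local Notation basis := (VLbasis r).
Local Notation bvec := (@bvec F r).
Local Notation H := 'rV[F]_r.
Local Notation mulvar := (@mulvar F r).
Local Notation dervar := (@dervar F r).

HB.instance Definition _ (a : H) (m : int) :=
  GRing.Linear.copy (heis G a m) (linext _).

Fact mulvar_is_linear q : linear (mulvar q).
Proof. by rewrite unlock; exact: linext_is_linear. Qed.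

Fact dervar_is_linear q : linear (dervar q).
Proof. by rewrite unlock; exact: linext_is_linear. Qed.

HB.instance Definition _ q :=
  GRing.isLinear.Build F V V *:%R (mulvar q) (mulvar_is_linear q).

HB.instance Definition _ q :=
  GRing.isLinear.Build F V V *:%R (dervar q) (dervar_is_linear q).

Lemma mulvarU q b :
  mulvar q (bvec b) = bvec (b.1, mulcm b.2 (ucm q)).
Proof. by rewrite mulvar.unlock linextU bvec.unlock. Qed.

Lemma dervarU q b : dervar q (bvec b) =
  (b.2 q)%:R *: bvec (b.1, divcm b.2 (ucm q)).
Proof. by rewrite dervar.unlock linextU bvec.unlock. Qed.

Lemma mulvarC p q v : mulvar p (mulvar q v) = mulvar q (mulvar p v).
Proof.
elim/VL_ind: v => [b|a u v hu hv]; last by rewrite !linearP /= hu hv.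
by rewrite !mulvarU /= -!mulcmA (mulcmC (ucm p)).
Qed.

Lemma dervarC p q v : dervar p (dervar q v) = dervar q (dervar p v).
Proof.
elim/VL_ind: v => [b|a u v hu hv]; last by rewrite !linearP /= hu hv.
rewrite dervarU [dervar p (bvec b)]dervarU linearZ [in RHS]linearZ /=.
rewrite (dervarU p) (dervarU q) !scalerA -!natrM /= divcmAC !divcmE !ucmE.
move: (bvec _) => w.
rewrite (eq_sym p); have [->|_] := eqVneq q p; first by [].
by rewrite !subn0 mulnC.
Qed.

(** The Weyl algebra relation, from which every contraction of Heisenberg modes arises. *)
Lemma dervar_mulvar p q v :
  dervar p (mulvar q v) = mulvar q (dervar p v) + (p == q)%:R *: v.
Proof.
elim/VL_ind: v => [b|a u v hu hv]; last first.
  by rewrite !linearP /= hu hv scalerDr addrACA.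
rewrite mulvarU !dervarU linearZ /= mulvarU /= mulcmE ucmE eq_sym.
have [->|npq] := eqVneq p q.
  (* Division of monomials truncates at exponent 0; the truncated monomial only occurs with
     coefficient 0. *)
  rewrite mulcmK -surjective_pairing; have [b0|b0] := eqVneq (b.2 q) 0%N.
    by rewrite b0 scale0r add0r.
  by rewrite divcmK // -surjective_pairing -scalerDl natrD.
rewrite addn0 scale0r addr0; have [->|b0] := eqVneq (b.2 p) 0%N.
  by rewrite !scale0r.
by rewrite divcm_mul.
Qed.

Lemma heis_negE (a : H) n v :
  heis G a (Negz n) v = \sum_(i < r) a 0 i *: mulvar (i, n) v.
Proof.
elim/VL_ind: v => [b|c u v hu hv].
  rewrite /heis linextU; apply: eq_bigr => i _; by rewrite mulvarU bvec.unlock.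
rewrite linearP /= hu hv scaler_sumr -big_split; apply: eq_bigr => i _ /=.
by rewrite linearP scalerDr !scalerA mulrC.
Qed.

Lemma heis_posE (a : H) (n : nat) v :
  heis G a n.+1 v =
  \sum_(i < r) (n.+1%:R * hform G a (delta_mx 0 i)) *: dervar (i, n) v.
Proof.
elim/VL_ind: v => [b|c u v hu hv].
  rewrite /heis linextU; apply: eq_bigr => i _.
  by rewrite dervarU scalerA bvec.unlock.
rewrite linearP /= hu hv scaler_sumr -big_split; apply: eq_bigr => i _ /=.
by rewrite linearP scalerDr !scalerA mulrC.
Qed.

Lemma hformDl (a b c : H) : hform G (a + b) c = hform G a c + hform G b c.
Proof. by rewrite /hform !mulmxDl mxE. Qed.

Lemma hformZl k (a c : H) : hform G (k *: a) c = k * hform G a c.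
Proof. by rewrite /hform -!scalemxAl mxE. Qed.

Lemma hformDr (a b c : H) : hform G c (a + b) = hform G c a + hform G c b.
Proof. by rewrite /hform linearD mulmxDr mxE. Qed.

Lemma hformZr k (a c : H) : hform G c (k *: a) = k * hform G c a.
Proof. by rewrite /hform linearZ /= -scalemxAr mxE. Qed.

Lemma hformNl (a c : H) : hform G (- a) c = - hform G a c.
Proof. by rewrite -scaleN1r hformZl mulN1r. Qed.

Lemma hformNr (a c : H) : hform G c (- a) = - hform G c a.
Proof. by rewrite -scaleN1r hformZr mulN1r. Qed.

Lemma hform0l (c : H) : hform G 0 c = 0.
Proof. by rewrite /hform !mul0mx mxE. Qed.

Lemma hform0r (c : H) : hform G c 0 = 0.
Proof. by rewrite /hform trmx0 mulmx0 mxE. Qed.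

Lemma hform_sumr (a b : H) : hform G a b = \sum_(i < r) b 0 i * hform G a
  (delta_mx 0 i).
Proof.
rewrite {1}[b]row_sum_delta /hform linear_sum /= mulmx_sumr summxE.
by apply: eq_bigr => i _; rewrite linearZ /= -scalemxAr mxE.
Qed.

Lemma hform_inh x y : hform G (inh F x) (inh F y) = (latform G x y)%:~R.
Proof. by rewrite /hform /inh map_trmx -!map_mxM mxE. Qed.

Lemma inhD x y : inh F (x + y : 'rV_r) = inh F x + inh F y.
Proof. by rewrite /inh map_mxD. Qed.

Lemma inhN x : inh F (- x : 'rV_r) = - inh F x.
Proof. by rewrite /inh map_mxN. Qed.

Lemma inh0 : inh F (0 : 'rV_r) = 0.
Proof. by rewrite /inh map_mx0. Qed.

Lemma latformDl x y z : latform G (x + y) z = latform G x z + latform G y z.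
Proof. by rewrite /latform !mulmxDl mxE. Qed.

Lemma latformDr x y z : latform G z (x + y) = latform G z x + latform G z y.
Proof. by rewrite /latform linearD mulmxDr mxE. Qed.

Lemma latformNl x y : latform G (- x) y = - latform G x y.
Proof. by rewrite /latform !mulNmx mxE. Qed.

Lemma latformNr x y : latform G y (- x) = - latform G y x.
Proof. by rewrite /latform linearN mulmxN mxE. Qed.

Hypothesis Gsym : forall x y, latform G x y = latform G y x.

Lemma hformC (a b : H) : hform G a b = hform G b a.
Proof.
have GT : G^T = G.
  apply/matrixP => i j; rewrite mxE; have := Gsym (delta_mx 0 j) (delta_mx 0 i).
  by rewrite /latform -!rowE !trmx_delta -!colE !mxE.
rewrite /hform; set M := map_mx _ G.
have -> : b *m M *m a^T = (a *m M *m b^T)^T.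
  by rewrite !trmx_mul trmxK map_trmx GT mulmxA.
by rewrite [RHS]mxE.
Qed.

End Heisenberg.

(** * Heisenberg commutation relations *)

Lemma sum_linear_comm (F : fieldType) (V : lmodType F) (I J : finType)
    (f : I -> {linear V -> V}) (g : J -> {linear V -> V}) (c : I -> F)
    (d : J -> F) (e : I -> J -> F) v :
  (forall i j, f i (g j v) = g j (f i v) + e i j *: v) ->
  \sum_i c i *: f i (\sum_j d j *: g j v) =
  \sum_j d j *: g j (\sum_i c i *: f i v)
  + (\sum_i \sum_j c i * d j * e i j) *: v.
Proof.
move=> fg.
transitivity (\sum_i (\sum_j (c i * d j) *: g j (f i v)
                    + \sum_j (c i * d j * e i j) *: v)).
  apply: eq_bigr => i _; rewrite linear_sum scaler_sumr -big_split /=.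
  apply: eq_bigr => j _; rewrite linearZ /= scalerA fg scalerDr.
  by rewrite scalerA.
rewrite big_split scaler_suml /=; congr (_ + _); last first.
  by apply: eq_bigr => i _; rewrite scaler_suml.
rewrite exchange_big /=; apply: eq_bigr => j _.
rewrite linear_sum scaler_sumr; apply: eq_bigr => i _.
by rewrite linearZ /= scalerA mulrC.
Qed.

Section HeisenbergRelations.
Variables (F : fieldType) (r : nat) (G : 'M[int]_r) (V : lmodType F).
Variables (mulop derop : 'I_r * nat -> {linear V -> V}).
Variable zeroop : 'rV[F]_r -> {linear V -> V}.
Local Notation H := 'rV[F]_r.
Local Notation "( a | b )" := (hform G a b).

Hypothesis Gsym : forall x y, latform G x y = latform G y x.
Hypothesis mulopC : forall p q v, mulop p (mulop q v) = mulop q (mulop p v).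
Hypothesis deropC : forall p q v, derop p (derop q v) = derop q (derop p v).
Hypothesis derop_mulop : forall p q v,
  derop p (mulop q v) = mulop q (derop p v) + (p == q)%:R *: v.
Hypothesis zeroopC : forall a b v, zeroop a (zeroop b v) = zeroop b
  (zeroop a v).
Hypothesis zeroop_mulop : forall a q v,
  zeroop a (mulop q v) = mulop q (zeroop a v).
Hypothesis zeroop_derop : forall a q v,
  zeroop a (derop q v) = derop q (zeroop a v).

(** [heis] over an abstract space: multiplication, derivation and zero modes enter only through
    their commutation relations. *)
Definition heis_op (a : H) (m : int) (v : V) : V :=
  match m with
  | Negz n => \sum_(i < r) a 0 i *: mulop (i, n) v
  | Posz 0 => zeroop a v
  | Posz n.+1 =>
      \sum_(i < r) (n.+1%:R * (a | delta_mx 0 i)) *: derop (i, n) v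
  end.

(** The only contraction that has to be computed: the variables (i, m) and (j, n) interact for i = j
    and m = n alone, and the remaining sum over i expands (a|b) in the coordinates of b. *)
Lemma heis_op_pos_neg (a b : H) (m n : nat) v :
  heis_op a m.+1 (heis_op b (Negz n) v) =
  heis_op b (Negz n) (heis_op a m.+1 v) + (m.+1%:R * (a | b) *+ (m == n)) *: v.
Proof.
rewrite /heis_op.
rewrite (sum_linear_comm _ _ (fun i j => derop_mulop (i, m) (j, n) v)).
congr (_ + _ *: _); under eq_bigr => i _.
  under eq_bigr => j _ do rewrite xpair_eqE -mulnb natrM mulrA.
  rewrite -mulr_suml (bigD1 i) //= eqxx mulr1 big1 ?addr0; last first.
    by move=> j nji; rewrite eq_sym (negbTE nji) mulr0.
  over.
rewrite -mulr_suml -[RHS]mulr_natr; congr (_ * _).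
rewrite [in RHS]hform_sumr mulr_sumr; apply: eq_bigr => i _.
by rewrite -mulrA [_ * b 0 i]mulrC.
Qed.

Lemma heis_op_comm (a b : H) (m n : int) v :
  heis_op a m (heis_op b n v) =
  heis_op b n (heis_op a m v) + (m%:~R * (a | b) *+ (m == - n)) *: v.
Proof.
have zero c d (k : int) w :
    heis_op c 0 (heis_op d k w) = heis_op d k (heis_op c 0 w).
  case: k => [[|k]|k] //=; rewrite linear_sum; apply: eq_bigr => i _.
    by rewrite linearZ /= zeroop_derop.
  by rewrite linearZ /= zeroop_mulop.
have comm0 (I : finType) (f g : I -> {linear V -> V}) (c d : I -> F) w :
    (forall i j, f i (g j w) = g j (f i w)) ->
    \sum_i c i *: f i (\sum_j d j *: g j w) =
    \sum_j d j *: g j (\sum_i c i *: f i w) + 0 *: w.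
  move=> fg; rewrite (@sum_linear_comm _ _ _ _ _ _ _ _ (fun _ _ => 0)).
    by rewrite [X in _ + X *: _]big1 // => i _; rewrite big1 // => j _;
      rewrite mulr0.
  by move=> i j; rewrite scale0r addr0 fg.
case: m n => [[|m]|m] [[|n]|n].
- by rewrite zero mul0r mul0rn scale0r addr0.
- by rewrite zero mul0r mul0rn scale0r addr0.
- by rewrite zero mul0r mul0rn scale0r addr0.
- by rewrite zero scale0r addr0.
- exact: comm0.
- by rewrite heis_op_pos_neg.
- by rewrite zero scale0r addr0.
(* The previous contraction read backwards: symmetry of the form and the sign of the negative index
   make the two scalars cancel. *)
- rewrite heis_op_pos_neg -addrA -scalerDl.
  rewrite [X in X *: v](_ : _ = 0) ?scale0r ?addr0 //.
  rewrite (hformC Gsym b a) NegzE mulrNz mulNr mulNrn.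
  rewrite [_ == - _ in X in - X](_ : _ = (n == m)); last first.
    by rewrite eqr_opp eqz_nat eqSS eq_sym.
  by case: eqP => [->|]; rewrite ?mulr0n ?mulr1n ?addrN ?subr0.
exact: comm0.
Qed.

Lemma heis_op_is_linear a m : linear (heis_op a m).
Proof.
move=> c u v; case: m => [[|n]|n]; first exact: linearP.
  rewrite /= scaler_sumr -big_split; apply: eq_bigr => i _ /=.
  by rewrite linearP scalerDr !scalerA mulrC.
rewrite /= scaler_sumr -big_split; apply: eq_bigr => i _ /=.
by rewrite linearP scalerDr !scalerA mulrC.
Qed.

End HeisenbergRelations.

(** * Reindexing of finite sums *)

Lemma sumr_ord_widen (V : nmodType) (f : nat -> V) (m n : nat) :
  (m <= n)%N -> (forall i, (m <= i)%N -> f i = 0) ->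
  \sum_(i < n) f i = \sum_(i < m) f i.
Proof.
move=> mn f0; rewrite (big_ord_widen n f mn) [RHS]big_mkcond /=.
by apply: eq_bigr => i _; case: ltnP => // /f0.
Qed.

(** Translation invariance of a sum over the integers: the support of [f] lies between 0 and n - s -
    1, so the shifted support still fits below n. *)
Lemma sumr_ord_shift (V : nmodType) (f : int -> V) (s n : nat) :
  (forall i, (i < 0) || (n%:Z <= i + s%:Z) -> f i = 0) ->
  \sum_(i < n) f (i%:Z - s%:Z) = \sum_(i < n) f i%:Z.
Proof.
move=> f0; case: (leqP s n) => [sn|ns]; last first.
  by rewrite !big1 // => i _; apply: f0; have := ltn_ord i; lia.
move: f0; rewrite -(subnKC sn); move: (n - s)%N => m f0 {sn n}.
rewrite [RHS](@sumr_ord_widen _ (fun i => f i%:Z) m) ?leq_addl => [|//|i mi].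
  rewrite big_split_ord /= big1 ?add0r => [|i _]; last first.
    by apply: f0; have := ltn_ord i; lia.
  by apply: eq_bigr => i _; congr f; lia.
by apply: f0; lia.
Qed.

(** * Exponentials of operator series *)

Section ExponentialSequence.
Variables (F : fieldType) (V : lmodType F).
Hypothesis F0 : [pchar F] =i pred0.

(* The coefficients of exp (sum_i c_i z^(i+1) / (i+1)), extended by 0 to
   negative degrees, are characterized by the logarithmic derivative. *)
Record expseq (c : nat -> V -> V) (E : int -> V -> V) : Prop := ExpSeq {
  expseq0 : forall v, E 0 v = v;
  expseq_lt0 : forall k v, k < 0 -> E k v = 0;
  expseq_rec : forall (k : int) (n : nat) v, k <= n%:Z ->
    k%:~R *: E k v = \sum_(i < n) c i (E (k - i.+1%:Z) v)
}.

Lemma intr_eq0_pchar0 (k : int) : (k%:~R == 0 :> F) = (k == 0).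
Proof.
have N0 := (pcharf0P F).1 F0.
case: k => n; first by rewrite -[_%:~R]/(n%:R) N0 eqz_nat.
by rewrite NegzE mulrNz oppr_eq0 -[_%:~R]/(n.+1%:R) N0.
Qed.

(** In characteristic 0 the factor k > 0 cancels, so the recursion determines every coefficient from
    the constant term. *)
Lemma expseq_uniq c E E' k v : expseq c E -> expseq c E' -> E k v = E' k v.
Proof.
move=> cE cE'; case: (ltrP k 0) => [k0|];
  first by rewrite (expseq_lt0 cE) ?(expseq_lt0 cE').
case: k => // k _; elim/ltn_ind: k => -[|k] IH.
  by rewrite (expseq0 cE) (expseq0 cE').
have k0 : (k.+1%:Z)%:~R != 0 :> F by rewrite intr_eq0_pchar0.
apply: (scalerI k0); rewrite (expseq_rec cE _ (lexx k.+1%:Z)).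
rewrite (expseq_rec cE' _ (lexx k.+1%:Z)); apply: eq_bigr => i _.
have ik := ltn_ord i; have -> : k.+1%:Z - i.+1%:Z = (k - i)%N by lia.
by rewrite IH //; lia.
Qed.

(* If d shifts log E by z^(p+1) t, then [d, E] = z^(p+1) t E. *)
Lemma expseq_der (c : nat -> {linear V -> V}) (E : int -> {linear V -> V})
    (d : {linear V -> V}) (p : nat) (t : F) :
  expseq c E ->
  (forall i v, d (c i v) = c i (d v) + (p.+1%:R * t *+ (i == p)) *: v) ->
  forall k v, d (E k v) = E k (d v) + t *: E (k - p.+1%:Z) v.
Proof.
move=> cE dc k v; case: (ltrP k 0) => [k0|].
  rewrite !(expseq_lt0 cE) ?linear0 ?scaler0 ?addr0 //; lia.
case: k => // k _; elim/ltn_ind: k => -[|k] IH.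
  by rewrite !(expseq0 cE) (expseq_lt0 cE) // scaler0 addr0.
have k0 : (k.+1%:Z)%:~R != 0 :> F by rewrite intr_eq0_pchar0.
apply: (scalerI k0); rewrite -linearZ /= (expseq_rec cE _ (lexx k.+1%:Z))
  scalerDr.
rewrite (expseq_rec cE _ (lexx k.+1%:Z)) linear_sum /=.
under eq_bigr => i _.
  rewrite dc (_ : k.+1%:Z - i.+1%:Z = (k - i)%N); last by have := ltn_ord i;
    lia.
  rewrite IH ?linearD; last by have := ltn_ord i; lia.
  rewrite /= linearZ /= -addrA.
  over.
rewrite big_split /=; congr (_ + _).
  apply: eq_bigr => i _; congr (c i (E _ _)); have := ltn_ord i; lia.
rewrite big_split /= -scaler_sumr.
(* In k + 1 = (k - p) + (p + 1) the first part is absorbed by the recursion in degree k - p, the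
   second matches the scalar from commuting [d] with [c p]. *)
have -> : (k.+1%:Z)%:~R = (k.+1%:Z - p.+1%:Z)%:~R + p.+1%:R :> F.
  by rewrite -[p.+1%:R]/((p.+1%:Z)%:~R) -intrD subrK.
rewrite scalerDl [_ *: (t *: _) in X in _ = X + _]scalerA [_%:~R * t]mulrC
  -[in RHS]scalerA (expseq_rec cE (n := k.+1)); last by lia.
congr (_ + _).
  congr (_ *: _); apply: eq_bigr => i _; congr (c i (E _ _)).
  have := ltn_ord i; lia.
case: (ltnP p k.+1) => [pk|kp].
  rewrite (bigD1 (Ordinal pk)) //= eqxx mulr1n big1 ?addr0; last first.
    move=> i; rewrite -val_eqE /= => /negbTE ->; by rewrite mulr0n scale0r.
  by rewrite scalerA mulrC; congr (_ *: E _ v); lia.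
rewrite (expseq_lt0 cE) ?scaler0; last by lia.
rewrite big1 // => i _; rewrite (_ : _ == _ = false) ?mulr0n ?scale0r //.
by have := ltn_ord i; lia.
Qed.

Lemma expseq_comm (c : nat -> {linear V -> V}) (E : int -> {linear V -> V})
    (d : {linear V -> V}) :
  expseq c E -> (forall i v, d (c i v) = c i (d v)) ->
  forall k v, d (E k v) = E k (d v).
Proof.
move=> cE dc k v; rewrite (@expseq_der c E d 0 0 cE) ?scale0r ?addr0 //.
by move=> i w; rewrite dc mulr0 mul0rn scale0r addr0.
Qed.

(* exp of a sum of commuting families is the product of the exponentials *)
Lemma expseq_conv (c c' : nat -> {linear V -> V}) (c'' : nat -> V -> V)
    (E E' : int -> {linear V -> V}) (E'' : int -> V -> V) :
  expseq c E -> expseq c' E' -> expseq c'' E'' ->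
  (forall i v, c'' i v = c i v + c' i v) ->
  (forall i j v, c i (c' j v) = c' j (c i v)) ->
  forall (k : int) (n : nat) v, k < n%:Z ->
    \sum_(i < n) E i (E' (k - i%:Z) v) = E'' k v.
Proof.
move=> cE cE' cE'' c''D cc' k n v kn.
(* Every range that exceeds k gives the same sum. With the range fixed, [R] is a candidate
   exponential sequence, and uniqueness reduces the claim to its recursion. *)
pose R k v := \sum_(i < `|k|.+1) E i (E' (k - i%:Z) v).
have RE (k1 : int) (n1 : nat) v1 : k1 < n1%:Z ->
    \sum_(i < n1) E i (E' (k1 - i%:Z) v1) = R k1 v1.
  move=> kn1; case: (ltrP k1 0) => [k10|k10].
    rewrite /R !big1 // => i _; rewrite (expseq_lt0 cE') ?linear0 //; lia.
  apply: (sumr_ord_widen (f := fun i => E i (E' (k1 - i%:Z) v1))) => [|i ki].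
    by lia.
  by rewrite (expseq_lt0 cE') ?linear0 //; lia.
rewrite RE //; apply: (@expseq_uniq c'') => // {k n v kn}; split.
- by move=> v; rewrite /R big_ord1 (expseq0 cE) (expseq0 cE').
- move=> k v k0; rewrite /R big1 // => i _.
  by rewrite (expseq_lt0 cE') ?linear0 //; lia.
move=> k n v kn; have kn1 : k < n.+1%:Z by lia.
have cE'C i : forall j v, c i (E' j v) = E' j (c i v).
  by apply: expseq_comm cE' _ => j w; rewrite cc'.
have c'EC i : forall j v, c' i (E j v) = E j (c' i v).
  by apply: expseq_comm cE _ => j w; rewrite cc'.
rewrite -(RE _ _ _ kn1) scaler_sumr.
(* The Leibniz rule: the degree splits as k = i + (k - i), and each factor uses its own
   recursion. *)
have step (i : 'I_n.+1) : k%:~R *: E i (E' (k - i%:Z) v) =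
    \sum_(j < n) c j (E (i%:Z - j.+1%:Z) (E' (k - i%:Z) v))
    + \sum_(j < n) c' j (E i%:Z (E' (k - j.+1%:Z - i%:Z) v)).
  rewrite -{1}(subrK i%:Z k) [_ - _ + _]addrC intrD scalerDl; congr (_ + _).
    by rewrite (expseq_rec cE (n := n)) //; have := ltn_ord i; lia.
  rewrite -linearZ /= (expseq_rec cE' (n := n)); last by lia.
  rewrite linear_sum; apply: eq_bigr => j _ /=.
  by rewrite c'EC; congr (E _ (c' _ (E' _ _))); lia.
rewrite (eq_bigr _ (fun i _ => step i)) big_split /=.
rewrite exchange_big [X in _ + X = _]exchange_big -big_split;
  apply: eq_bigr => j _ /=.
rewrite c''D -!linear_sum /=; congr (c j _ + c' j _).
  rewrite -(RE (k - j.+1%:Z) n.+1) //; last by lia.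
  pose f (i : int) := E i (E' (k - j.+1%:Z - i) v).
  rewrite -[RHS](@sumr_ord_shift _ f j.+1); last first.
    move=> i /orP[i0|ni]; first by rewrite /f (expseq_lt0 cE).
    by rewrite /f (expseq_lt0 cE') ?linear0 //; lia.
  by apply: eq_bigr => i _; congr (E _ (E' _ _)); lia.
by rewrite RE //; lia.
Qed.

End ExponentialSequence.

(** * Exponential of an operator series without constant term *)

Section OperatorSeries.
Variables (F : fieldType) (V : lmodType F).
Hypothesis F0 : [pchar F] =i pred0.

Definition ser_one (l : nat) (v : V) : V := if l is 0%N then v else 0.

Definition ser_mul (A B : nat -> V -> V) (l : nat) (v : V) : V :=
  \sum_(i < l.+1) A i (B (l - i)%N v).

Definition ser_exp (A : nat -> V -> V) (l : nat) (v : V) : V :=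
  \sum_(m < l.+1) (m`!%:R)^-1 *: iter m (ser_mul A) ser_one l v.

Definition ser_ext (P : nat -> V -> V) (k : int) (v : V) : V :=
  if k is Posz j then P j v else 0.

Variable A : nat -> {linear V -> V}.
Hypothesis A0 : forall v, A 0%N v = 0.
Hypothesis AC : forall i j v, A i (A j v) = A j (A i v).

Let B (m : nat) := ser_ext (iter m (ser_mul A) ser_one).
Let c (i : nat) (v : V) := i.+1%:R *: A i.+1 v.

Let B_lt0 m k v : k < 0 -> B m k v = 0. Proof. by case: k. Qed.

Let B0 k v : B 0 k v = if k == 0 then v else 0.
Proof. by case: k => [[]|]. Qed.

Let BS m (k : int) (n : nat) v : k <= n%:Z ->
  B m.+1 k v = \sum_(i < n) A i.+1 (B m (k - i.+1%:Z) v).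
Proof.
case: k => [k|k] kn; last first.
  by rewrite B_lt0 ?big1 // => i _; rewrite B_lt0 ?linear0 //; lia.
rewrite [LHS]/= {1}/ser_mul big_ord_recl A0 add0r.
rewrite [RHS](@sumr_ord_widen _ (fun i => A i.+1 (B m (k%:Z - i.+1%:Z) v)) k)
  //.
  apply: eq_bigr => i _; congr (A _ _).
  rewrite (_ : _ - _ = (k - lift ord0 i)%N%:Z) //; have := ltn_ord i;
    rewrite /= /bump; lia.
by move=> i ki; rewrite B_lt0 ?linear0 //; lia.
Qed.

(** Without constant term, the m-th power starts in degree m; the truncation in [ser_exp] thus loses
    nothing. *)
Let B_vanish m k v : k < m%:Z -> B m k v = 0.
Proof.
elim: m k => [|m IH] k km; first exact: B_lt0.
rewrite (@BS _ _ `|k|%N); last by lia.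
by rewrite big1 // => i _; rewrite IH ?linear0 //; lia.
Qed.

Let B_linear m k : linear (B m k).
Proof.
elim: m k => [|m IH] k a u v; rewrite ?B0.
  by case: ifP => // _; rewrite scaler0 addr0.
rewrite !(@BS _ _ `|k|%N); try by lia.
rewrite scaler_sumr -big_split; apply: eq_bigr => i _ /=.
by rewrite IH linearP.
Qed.

(** The derivative of A^(m+1) is (m + 1) A' A^m because the coefficients of A commute; [c] lists
    those of A'. *)
Let B_rec m (k : int) (n : nat) v : k <= n%:Z ->
  k%:~R *: B m.+1 k v = m.+1%:R *: \sum_(i < n) c i (B m (k - i.+1%:Z) v).
Proof.
elim: m k n => [|m IH] k n kn.
  rewrite scale1r (BS _ _ kn) scaler_sumr; apply: eq_bigr => i _.
  rewrite /c !B0; case: eqP => [ki|_]; last by rewrite linear0 !scaler0.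
  by rewrite (_ : k = i.+1%:Z) //; lia.
rewrite (BS _ _ kn) scaler_sumr.
have step (i : 'I_n) : k%:~R *: A i.+1 (B m.+1 (k - i.+1%:Z) v) =
    c i (B m.+1 (k - i.+1%:Z) v)
    + \sum_(j < n) m.+1%:R *: c j (A i.+1 (B m (k - j.+1%:Z - i.+1%:Z) v)).
  rewrite -{1}(subrK i.+1%:Z k) [_ - _ + _]addrC intrD scalerDl; congr (_ + _).
  rewrite -linearZ /= (IH _ n); last by lia.
  rewrite linearZ /= linear_sum scaler_sumr /=; apply: eq_bigr => j _.
  rewrite /c linearZ /= AC; congr (_ *: (_ *: A _ (A _ (B _ _ _)))); lia.
rewrite (eq_bigr _ (fun i _ => step i)) big_split /= exchange_big /=.
rewrite -[in RHS]natr1 scalerDl scale1r addrC; congr (_ + _).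
rewrite scaler_sumr; apply: eq_bigr => j _; rewrite -scaler_sumr /c.
rewrite -scaler_sumr -linear_sum (@BS _ _ n) //; lia.
Qed.

Lemma ser_extE (k : int) (n : nat) v : k < n%:Z ->
  ser_ext (ser_exp A) k v = \sum_(m < n) (m`!%:R)^-1 *: B m k v.
Proof.
case: k => [k|k] kn; last by rewrite /= big1 // => m _; rewrite scaler0.
rewrite [RHS](@sumr_ord_widen _ (fun m => (m`!%:R)^-1 *: B m k v) k.+1) //.
by move=> m km; rewrite B_vanish ?scaler0 //; lia.
Qed.

Lemma ser_exp_is_linear k : linear (ser_ext (ser_exp A) k).
Proof.
move=> a u v; rewrite !(@ser_extE _ `|k|.+1); try by lia.
rewrite scaler_sumr -big_split; apply: eq_bigr => m _ /=.
by rewrite B_linear scalerDr !scalerA mulrC.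
Qed.

(** Differentiating the exponential term by term, the factor m + 1 of [B_rec] turns 1/(m+1)! into
    1/m! and lowers the power by one. *)
Lemma ser_exp_expseq : expseq c (ser_ext (ser_exp A)).
Proof.
split=> [v|k v|k n v kn].
- by rewrite /= /ser_exp big_ord1 /= invr1 scale1r.
- by case: k.
rewrite (@ser_extE _ n.+1); last by lia.
rewrite scaler_sumr big_ord_recl /= B0.
rewrite [X in X + _](_ : _ = 0); last first.
  by case: eqP => [->|_]; rewrite ?scale0r // !scaler0.
rewrite add0r.
have step (m : 'I_n) : k%:~R *: (((lift ord0 m)`!%:R)^-1 *: B (lift ord0 m) k v)
  =
    \sum_(i < n) c i ((m`!%:R)^-1 *: B m (k - i.+1%:Z) v).
  rewrite scalerA mulrC -scalerA /= /bump add1n (B_rec _ _ kn) scalerA factS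
    natrM.
  rewrite invfM -mulrA mulrCA mulVf; last by rewrite ((pcharf0P F).1 F0).
  rewrite mulr1 scaler_sumr; apply: eq_bigr => i _.
  by rewrite /c !linearZ /= !scalerA mulrC.
rewrite (eq_bigr _ (fun m _ => step m)) exchange_big /=; apply: eq_bigr => i _.
rewrite /c -scaler_sumr -linear_sum -ser_extE //; have := ltn_ord i; lia.
Qed.

End OperatorSeries.

(** * Sums of finite support and uniform bounds *)

Lemma fsum_nat (V : nmodType) (f : nat -> V) (K : nat) :
  (forall j, (K <= j)%N -> f j = 0) -> \sum_(j \in [set: nat]) f j =
    \sum_(j < K) f j.
Proof.
move=> f0; rewrite fsbig_ord; symmetry; apply: fsbig_widen => // j [_ /= /negP].
by rewrite -leqNgt => /f0.
Qed.

(** There are s + 1 pairs with i + j = s; this is the origin of the weights in [pole_sum]. *)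
Lemma sumr_antidiagonal (V : nmodType) (h : nat -> V) (K K' : nat) :
  (K <= K')%N -> (forall s, (K <= s)%N -> h s = 0) ->
  \sum_(j < K) \sum_(i < K') h (i + j)%N = \sum_(s < K) h s *+ s.+1.
Proof.
move=> KK' h0.
transitivity (\sum_(j < K) \sum_(s < K) (if (j <= s)%N then h s else 0)).
  apply: eq_bigr => j _; pose f s := if (j <= s)%N then h s else 0.
  rewrite -(@sumr_ord_widen _ f K (j + K')); last first.
  - by move=> s Ks; rewrite /f h0 // if_same.
  - by lia.
  rewrite big_split_ord /= [X in _ = X + _]big1 ?add0r => [|i _]; last first.
    by rewrite /f /= leqNgt ltn_ord.
  by apply: eq_bigr => i _; rewrite /f /= leq_addr addnC.
rewrite exchange_big; apply: eq_bigr => s _ /=; rewrite -big_mkcond /=.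
rewrite sumr_const; congr (_ *+ _).
rewrite -sum1_card -(big_ord_widen K (fun=> 1%N) (ltn_ord s)).
by rewrite sum1_card card_ord.
Qed.

Lemma finite_eventually (P : nat -> nat -> Prop) :
  (forall j, exists T, forall K, (T <= K)%N -> P j K) ->
  forall n, exists T, forall K, (T <= K)%N -> forall j, (j < n)%N -> P j K.
Proof.
move=> hP; elim=> [|n [T hT]]; first by exists 0%N.
have [T' hT'] := hP n; exists (T + T')%N => K TK j; rewrite ltnS leq_eqVlt.
by case/predU1P => [->|jn]; [apply: hT'; lia|apply: hT => //; lia].
Qed.

(** * Vertex operators of null vectors *)

Section NormalProduct.
Variables (F : fieldType) (V : lmodType F).

Definition nprod (A B : int -> V -> V) (n : int) (v : V) : V :=
  \sum_(j \in [set: nat]) A (- j%:Z - 1) (B (n + j%:Z) v)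
  + \sum_(j \in [set: nat]) B (n - j%:Z - 1) (A j%:Z v).

End NormalProduct.

Section VertexOperators.
Variables (F : fieldType) (r : nat) (G : 'M[int]_r) (V : lmodType F).
Variable eps : 'rV[int]_r -> 'rV[int]_r -> F.
Hypothesis F0 : [pchar F] =i pred0.
Hypothesis Gsym : forall x y, latform G x y = latform G y x.

Local Notation H := 'rV[F]_r.
Local Notation L := 'rV[int]_r.
Local Notation "( a | b )" := (hform G a b).
Local Notation inh := (inh F).

Variable hm : H -> int -> {linear V -> V}.
Hypothesis hmD : forall a b m v, hm (a + b) m v = hm a m v + hm b m v.
Hypothesis hm_comm : forall a b m n v,
  hm a m (hm b n v) = hm b n (hm a m v) + (m%:~R * (a | b) *+ (m == - n)) *: v.

Variables (P Q : L -> int -> {linear V -> V}) (S : L -> {linear V -> V}).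
Hypothesis P_expseq : forall x,
  expseq (fun i => hm (inh x) (- i.+1%:Z)) (P x).
Hypothesis Q_expseq : forall x,
  expseq (fun i => (-%R \o hm (inh x) i.+1%:Z : {linear V -> V})) (Q x).
Hypothesis hm_S : forall a m x v,
  hm a m (S x v) = S x (hm a m v) + ((a | inh x) *+ (m == 0)) *: S x v.
Hypothesis S_S : forall x y v, S x (S y v) = eps x y *: S (x + y) v.

(* v has lattice degree t, read off from the eigenvalues of the zero modes *)
Definition homogeneous (t : L) (v : V) :=
  forall a, hm a 0 v = (a | inh t) *: v.

Hypothesis homogeneous_ind : forall Pr : V -> Prop,
  (forall t v, homogeneous t v -> Pr v) ->
  (forall a u v, Pr u -> Pr v -> Pr (a *: u + v)) -> forall v, Pr v.

Variable E : L -> int -> {linear V -> V}.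
(** The exponent of z^(x_(0)) is a number only on vectors of a fixed degree. Any K beyond which [Q]
    kills the vector is allowed, so that several sums can share one range. *)
Hypothesis E_homogeneous : forall x t n (K : nat) v, homogeneous t v ->
  (forall l : nat, (K <= l)%N -> Q x l%:Z v = 0) ->
  E x n v =
    \sum_(l < K) P x (l%:Z - n - 1 - latform G x t) (S x (Q x l%:Z v)).

Hypothesis hm_nil : forall a v,
  exists K : nat, forall n : nat, (K <= n)%N -> hm a n v = 0.
Hypothesis Q_nil : forall x v,
  exists K : nat, forall l : nat, (K <= l)%N -> Q x l v = 0.

Lemma hm_comm0 a b m n v : m != - n -> hm a m (hm b n v) = hm b n (hm a m v).
Proof. by move=> mn; rewrite hm_comm (negbTE mn) scale0r addr0. Qed.

Lemma hm_P0 a m x k v : m <= 0 -> hm a m (P x k v) = P x k (hm a m v).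
Proof.
by move=> m0; apply: (@expseq_comm _ _ F0 _ _ _ (P_expseq x)) => i w;
  apply: hm_comm0; lia.
Qed.

Lemma hm_P a (p : nat) x k v :
  hm a p.+1 (P x k v) = P x k (hm a p.+1 v) + (a | inh x) *: P x (k - p.+1%:Z)
    v.
Proof.
apply: (expseq_der F0 (P_expseq x)) => i w; rewrite hm_comm opprK eqz_nat eqSS.
by rewrite eq_sym.
Qed.

Lemma hm_Q0 a m x k v : 0 <= m -> hm a m (Q x k v) = Q x k (hm a m v).
Proof.
move=> m0; apply: (@expseq_comm _ _ F0 _ _ _ (Q_expseq x)) => i w /=.
by rewrite linearN hm_comm0 //; lia.
Qed.

Lemma hm_Q a (p : nat) x k v :
  hm a (- p.+1%:Z) (Q x k v) =
  Q x k (hm a (- p.+1%:Z) v) + (a | inh x) *: Q x (k - p.+1%:Z) v.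
Proof.
apply: (expseq_der F0 (Q_expseq x)) => i w /=.
rewrite linearN hm_comm opprD -scaleNr eqr_opp eqz_nat eqSS eq_sym;
  congr (_ + _ *: _).
by rewrite mulrNz mulNr mulNrn opprK.
Qed.

Lemma Q_annihilated x v (l : nat) :
  (forall a (n : nat), hm a n.+1 v = 0) -> (0 < l)%N -> Q x l v = 0.
Proof.
case: l => // l hv _; have lF : (l.+1%:Z)%:~R != 0 :> F by rewrite
  intr_eq0_pchar0.
apply: (scalerI lF); rewrite (expseq_rec (Q_expseq x) (n := l.+1)) // scaler0.
by rewrite big1 // => i _ /=; rewrite hm_Q0 // hv linear0 oppr0.
Qed.

Lemma homogeneous_S t x v : homogeneous t v -> homogeneous (t + x) (S x v).
Proof.
by move=> tv a; rewrite hm_S tv linearZ inhD hformDr scalerDl eqxx mulr1n.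
Qed.

Lemma homogeneous_hm t a m v : homogeneous t v -> homogeneous t (hm a m v).
Proof.
move=> tv b; rewrite hm_comm mul0r mul0rn scale0r addr0 tv.
by rewrite linearZ.
Qed.

Lemma homogeneous_P t x k v : homogeneous t v -> homogeneous t (P x k v).
Proof. by move=> tv a; rewrite hm_P0 // tv linearZ. Qed.

Lemma homogeneous_Q t x k v : homogeneous t v -> homogeneous t (Q x k v).
Proof. by move=> tv a; rewrite hm_Q0 // tv linearZ. Qed.

Lemma homogeneous_sum t I (s : seq I) (f : I -> V) :
  (forall i, homogeneous t (f i)) -> homogeneous t (\sum_(i <- s) f i).
Proof.
move=> tf a; rewrite linear_sum scaler_sumr; apply: eq_bigr => i _; exact: tf.
Qed.

Lemma homogeneous_E t x n v : homogeneous t v -> homogeneous (t + x) (E x n v).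
Proof.
move=> tv; have [K QK] := Q_nil x v; rewrite (E_homogeneous _ tv QK).
apply: homogeneous_sum => l.
by apply/homogeneous_P/homogeneous_S/homogeneous_Q.
Qed.

(** Each mode has a contraction with one factor only: with [P] for m > 0, with [S] for m = 0, with
    [Q] for m < 0. In the outer cases it lowers the degree of that factor by |m|, which amounts to
    replacing n by n + m. *)
Lemma hm_E a m x n v :
  hm a m (E x n v) = E x n (hm a m v) + (a | inh x) *: E x (n + m) v.
Proof.
elim/homogeneous_ind: v => [t v tv|c u v hu hv]; last first.
  by rewrite !linearP /= hu hv scalerDr addrACA.
have [K1 QK1] := Q_nil x v; have [K2 QK2] := Q_nil x (hm a m v).
(* The summand |m| leaves room for the shift of the summation index when m < 0. *)
pose K := (K1 + K2 + `|m|)%N.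
have QK1' (l : nat) : (K <= l)%N -> Q x l v = 0 by move=> ?; apply: QK1; lia.
have QK2' (l : nat) : (K <= l)%N -> Q x l (hm a m v) = 0.
  by move=> ?; apply: QK2; lia.
rewrite !(E_homogeneous _ tv QK1') (E_homogeneous _ (homogeneous_hm a m tv)
  QK2').
rewrite linear_sum; case: m @K QK1' QK2' {QK2} => [[|m]|m] K QK1' QK2'.
- rewrite scaler_sumr -big_split; apply: eq_bigr => l _ /=.
  rewrite hm_P0 // hm_S eqxx mulr1n linearD linearZ hm_Q0 //=.
  by rewrite addr0.
- rewrite scaler_sumr -big_split; apply: eq_bigr => l _ /=.
  rewrite hm_P hm_S mulr0n scale0r addr0 hm_Q0 //; congr (_ + _ *: P x _ _).
  by lia.
have p0 : (- m.+1%:Z == 0) = false by lia.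
pose f (l : int) := P x (l + m.+1%:Z - n - 1 - latform G x t) (S x (Q x l v)).
rewrite (_ : \sum_(i < K) P x (i%:Z - (n + Negz m) - 1 - latform G x t) _ =
    \sum_(i < K) f (i%:Z - m.+1%:Z)); last first.
  rewrite (@sumr_ord_shift _ f m.+1); last first.
    move=> i /orP[i0|Ki]; rewrite /f; first by rewrite (expseq_lt0 (Q_expseq x))
      ?linear0.
    case: i Ki => [i|i] Ki; last by rewrite (expseq_lt0 (Q_expseq x)) ?linear0.
    by rewrite QK1 ?linear0 //; rewrite /K in Ki; lia.
  apply: eq_bigr => l _; congr (P x _ _); lia.
rewrite scaler_sumr -big_split; apply: eq_bigr => l _ /=.
rewrite NegzE hm_P0; last by lia.
rewrite hm_S p0 mulr0n scale0r addr0 hm_Q !linearD !linearZ /= /f.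
by congr (_ + _ *: P x _ _); lia.
Qed.

Lemma hm_S0 a m x v : m != 0 -> hm a m (S x v) = S x (hm a m v).
Proof. by move=> m0; rewrite hm_S (negbTE m0) mulr0n scale0r addr0. Qed.

Lemma P_S x y k v : P x k (S y v) = S y (P x k v).
Proof.
symmetry; apply: (@expseq_comm _ _ F0 _ _ (S y) (P_expseq x)) => i w.
by rewrite hm_S0.
Qed.

Lemma Q_S x y k v : Q x k (S y v) = S y (Q x k v).
Proof.
symmetry; apply: (@expseq_comm _ _ F0 _ _ (S y) (Q_expseq x)) => i w /=.
by rewrite hm_S0 // linearN.
Qed.

Lemma S_comm x y v : eps x y = eps y x -> S x (S y v) = S y (S x v).
Proof. by move=> exy; rewrite !S_S exy addrC. Qed.

Lemma P_P x y k l v : P x k (P y l v) = P y l (P x k v).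
Proof.
symmetry; apply: (@expseq_comm _ _ F0 _ _ (P y l) (P_expseq x)) => i w.
by rewrite hm_P0 // oppr_le0.
Qed.

Lemma Q_Q x y k l v : Q x k (Q y l v) = Q y l (Q x k v).
Proof.
symmetry; apply: (@expseq_comm _ _ F0 _ _ (Q y l) (Q_expseq x)) => i w /=.
by rewrite hm_Q0 // linearN.
Qed.

Lemma PD x y (k : int) (n : nat) v : k < n%:Z ->
  \sum_(i < n) P x i%:Z (P y (k - i%:Z) v) = P (x + y) k v.
Proof.
apply: (expseq_conv F0 (P_expseq x) (P_expseq y) (P_expseq (x + y))) =>
  [i w|i j w].
  by rewrite inhD hmD.
by apply: hm_comm0; lia.
Qed.

Lemma QD x y (k : int) (n : nat) v : k < n%:Z ->
  \sum_(i < n) Q x i%:Z (Q y (k - i%:Z) v) = Q (x + y) k v.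
Proof.
apply: (expseq_conv F0 (Q_expseq x) (Q_expseq y) (Q_expseq (x + y))) =>
  [i w|i j w] /=.
  by rewrite inhD hmD opprD.
by rewrite !linearN hm_comm0 //; lia.
Qed.

(** * Products of vertex operators of orthogonal vectors *)

Section Orthogonal.
Variables x y : L.
Hypothesis xy0 : latform G x y = 0.

Let hm_Ex n m v : hm (inh y) m (E x n v) = E x n (hm (inh y) m v).
Proof. by rewrite hm_E hform_inh Gsym xy0 scale0r addr0. Qed.

Lemma E_P n k v : E x n (P y k v) = P y k (E x n v).
Proof. by apply: (@expseq_comm _ _ F0 _ _ (E x n) (P_expseq y)) => i w. Qed.

Lemma E_Q n k v : E x n (Q y k v) = Q y k (E x n v).
Proof.
by apply: (@expseq_comm _ _ F0 _ _ (E x n) (Q_expseq y)) => i w /=;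
  rewrite linearN hm_Ex.
Qed.

Hypothesis exy : eps x y = eps y x.

Lemma E_S n v : E x n (S y v) = S y (E x n v).
Proof.
elim/homogeneous_ind: v => [t v tv|c u v hu hv];
  last by rewrite !linearP /= hu hv.
have [K QK] := Q_nil x v.
have QSK l : (K <= l)%N -> Q x l (S y v) = 0 by move=> Kl;
  rewrite Q_S QK ?linear0.
rewrite (E_homogeneous _ tv QK) (E_homogeneous _ (homogeneous_S y tv) QSK).
rewrite linear_sum; apply: eq_bigr => l _ /=.
by rewrite Q_S S_comm // P_S latformDr xy0 addr0.
Qed.

(** E^x commutes with the modes of y since (x|y) = 0, hence with both exponentials in E^y; for the
    shift it takes the symmetry of the cocycle on x and y. *)
Lemma E_E m n v : E x m (E y n v) = E y n (E x m v).
Proof.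
elim/homogeneous_ind: v => [t v tv|c u v hu hv];
  last by rewrite !linearP /= hu hv.
have [K QK] := Q_nil y v.
have QEK l : (K <= l)%N -> Q y l (E x m v) = 0 by move=> Kl;
  rewrite -E_Q QK ?linear0.
rewrite (E_homogeneous _ tv QK) (E_homogeneous _ (homogeneous_E x m tv) QEK).
rewrite linear_sum; apply: eq_bigr => l _ /=.
by rewrite E_P E_S E_Q latformDr [latform G y x]Gsym xy0 addr0.
Qed.

End Orthogonal.

Lemma E_nil x v : exists K : nat, forall n : int, K%:Z <= n -> E x n v = 0.
Proof.
elim/homogeneous_ind: v => [t v tv|c u v [Ku hu] [Kv hv]]; last first.
  exists (Ku + Kv)%N => n Kn; rewrite linearP hu ?hv ?scaler0 ?addr0 //; lia.
have [K QK] := Q_nil x v; exists (K + `|latform G x t|)%N => n Kn.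
rewrite (E_homogeneous _ tv QK) big1 // => l _;
  rewrite (expseq_lt0 (P_expseq x)) //.
have := ltn_ord l; lia.
Qed.

(** Creation parts are collected on the left and annihilation parts on the right, so that [PD],
    [S_S] and [QD] can fuse them separately. *)
Lemma E_E_homogeneous x y t m n A v :
  latform G x y = 0 -> eps x y = eps y x -> homogeneous t v ->
  (forall l : nat, (A <= l)%N -> Q x l v = 0) ->
  (forall l : nat, (A <= l)%N -> Q y l v = 0) ->
  E x m (E y n v) = \sum_(l < A) \sum_(l' < A)
    P x (l%:Z - m - 1 - latform G x t) (P y (l'%:Z - n - 1 - latform G y t)
      (S x (S y (Q x l (Q y l' v))))).
Proof.
move=> xy0 exy tv QxA QyA; rewrite (E_homogeneous _ tv QyA) linear_sum
  exchange_big.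
apply: eq_bigr => l' _ /=; rewrite E_P // E_S //.
rewrite (E_homogeneous (K := A) _ (homogeneous_Q y l' tv)); last first.
  by move=> l Al; rewrite Q_Q QxA ?linear0.
rewrite !linear_sum; apply: eq_bigr => l _ /=.
by rewrite -P_S P_P (S_comm _ exy).
Qed.

(** The two halves of a normally ordered partial sum run through the interval from a - K to a + K -
    1; once it covers the support they form one ordinary sum. *)
Lemma sumr_window (f : int -> V) (a : int) (N K : nat) :
  (forall i, [|| i < 0, N%:Z <= i | a + K%:Z <= i] -> f i = 0) -> a <= K%:Z ->
  \sum_(j < K) (f (a + j%:Z) + f (a - 1 - j%:Z)) = \sum_(i < N) f i%:Z.
Proof.
move=> f0 aK; have [s sE] : exists s : nat, s%:Z = K%:Z - a.
  by exists `|K%:Z - a|%N; lia.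
rewrite big_split /= addrC (reindex_inj rev_ord_inj) /=.
transitivity (\sum_(i < K + K) f (i%:Z - s%:Z)).
  rewrite big_split_ord /=; congr (_ + _); apply: eq_bigr => i _; congr f.
    by have := ltn_ord i; lia.
  by lia.
rewrite sumr_ord_shift; last by move=> i /orP[i0|Ki]; apply: f0; lia.
transitivity (\sum_(i < N + (K + K)) f i%:Z); last first.
  by apply: (sumr_ord_widen (f := fun i => f i%:Z)) => [|i Ni];
    [lia|apply: f0; lia].
symmetry.
by apply: (sumr_ord_widen (f := fun i => f i%:Z)) => [|i Ni];
  [lia|apply: f0; lia].
Qed.

(* E^x(z) E^y(z) = eps(x, y) E^(x+y)(z) *)
Lemma E_fusion x y v : latform G x y = 0 -> eps x y = eps y x ->
  exists K0 : nat, forall (K : nat) (m n : int),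
    K0%:Z <= K%:Z + m -> K0%:Z <= K%:Z + n ->
  \sum_(j < K) (E x (m - j%:Z - 1) (E y (n + j%:Z) v)
                + E y (n - j%:Z - 1) (E x (m + j%:Z) v))
  = eps x y *: E (x + y) (m + n) v.
Proof.
move=> xy0 exy; elim/homogeneous_ind: v => [t v tv|c u v [Ku hu] [Kv hv]];
  last first.
  exists (Ku + Kv)%N => K m n Km Kn.
  rewrite linearP scalerDr scalerA mulrC -scalerA -(hu K) -?(hv K); try by lia.
  rewrite scaler_sumr -big_split; apply: eq_bigr => j _ /=.
  by rewrite !linearP /= scalerDr addrACA.
have [A1 QxA1] := Q_nil x v; have [A2 QyA2] := Q_nil y v.
pose A := (A1 + A2)%N.
have QxA (l : nat) : (A <= l)%N -> Q x l v = 0 by move=> ?; apply: QxA1; lia.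
have QyA (l : nat) : (A <= l)%N -> Q y l v = 0 by move=> ?; apply: QyA2; lia.
pose sx := latform G x t; pose sy := latform G y t.
(* With this bound the interval in [sumr_window] covers the support for all l, l' < A. *)
exists (A + `|sx| + `|sy|)%N => K m n Km Kn.
under eq_bigr => j _.
  rewrite -(E_E xy0 exy) !(E_E_homogeneous _ _ xy0 exy tv QxA QyA) -big_split
    /=.
  under eq_bigr => l _ do rewrite -big_split /=.
  over.
rewrite exchange_big /=.
pose g (k : int) (w : V) := P (x + y) (k - m - n - 1 - sx - sy) (S (x + y) w).
transitivity (eps x y *: \sum_(l < A) \sum_(l' < A) g (l%:Z + l'%:Z)
  (Q x l (Q y l' v))).
  rewrite scaler_sumr; apply: eq_bigr => l _.
  rewrite exchange_big scaler_sumr; apply: eq_bigr => l' _ /=.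
  set w := Q x l _; rewrite /g -linearZ /= -S_S; set k : int := (X in P _ X _).
  pose f (i : int) := P x i (P y (k - i) (S x (S y w))).
  have lA := ltn_ord l; have l'A := ltn_ord l'; pose a : int := l%:Z - m - sx.
  rewrite -[RHS](@PD _ _ _ `|k|.+1); last by lia.
  rewrite -(@sumr_window f a `|k|.+1 K); last by rewrite /a; lia.
    apply: eq_bigr => j _; rewrite /f /k /a /sx /sy.
    by congr (P _ _ (P _ _ _) + P _ _ (P _ _ _)); lia.
  move=> i i0; case: (ltrP i 0) => [?|i1]; rewrite /f.
    by rewrite (expseq_lt0 (P_expseq x)).
  by rewrite (expseq_lt0 (P_expseq y)) ?linear0 //; rewrite /k;
    rewrite /a /k in i0; lia.
congr (_ *: _).
have QxyA (k : nat) : (A + A <= k)%N -> Q (x + y) k v = 0.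
  move=> Ak; rewrite -(@QD x y k k.+1) ?ltz_nat ?ltnSn // big1 // => i _.
  case: (ltnP i A) => iA; last by rewrite Q_Q QxA ?linear0.
  have ik := ltn_ord i; rewrite (_ : k%:Z - i%:Z = (k - i)%N); last by lia.
  by rewrite QyA ?linear0 //; lia.
rewrite (E_homogeneous _ tv QxyA).
(* The terms are regrouped by k = l + l', which stays below A + A; for fixed k the inner sum is then
   [QD]. *)
transitivity (\sum_(i < A + A) \sum_(k < A + A) g k%:Z
  (Q x i (Q y (k%:Z - i%:Z) v))).
  rewrite [RHS](@sumr_ord_widen _ (fun i : nat =>
    \sum_(k < A + A) g k%:Z (Q x i (Q y (k%:Z - i%:Z) v))) A) ?leq_addr //;
      last first.
    move=> i Ai; rewrite big1 // => k _.
    by rewrite Q_Q QxA // /g !linear0.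
  apply: eq_bigr => i _.
  pose f (j : int) := g (j + i%:Z) (Q x i (Q y j v)).
  transitivity (\sum_(k < A + A) f (k%:Z - i%:Z)); last first.
    by apply: eq_bigr => k _; rewrite /f subrK.
  rewrite sumr_ord_shift; last first.
    move=> j /orP[j0|Aj]; rewrite /f; first by rewrite (expseq_lt0 (Q_expseq y))
      // /g !linear0.
    case: j Aj => [j|j] Aj; last by rewrite (expseq_lt0 (Q_expseq y)) // /g
      !linear0.
    by rewrite QyA // /g ?linear0 //; have := ltn_ord i; lia.
  rewrite [RHS](@sumr_ord_widen _ (fun k : nat => f k) A) ?leq_addr //.
    by apply: eq_bigr => k _; rewrite /f addrC.
  by move=> k Ak; rewrite /f QyA // /g !linear0.
rewrite exchange_big; apply: eq_bigr => k _ /=.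
rewrite -(@QD x y k (A + A)) ?ltz_nat ?ltn_ord // /g !linear_sum.
apply: eq_bigr => i _; rewrite latformDl /sx /sy; congr (P _ _ _); lia.
Qed.

(* d/dz E^x(z) = :x(z) E^x(z): *)
Lemma E_derivative x n v : exists K0 : nat, forall K : nat, (K0 <= K)%N ->
  \sum_(j < K) (hm (inh x) (- j%:Z - 1) (E x (n + j%:Z) v)
                + E x (n - j%:Z - 1) (hm (inh x) j%:Z v))
  = - n%:~R *: E x (n - 1) v.
Proof.
elim/homogeneous_ind: v => [t v tv|c u v [Ku hu] [Kv hv]]; last first.
  exists (Ku + Kv)%N => K hK.
  rewrite linearP scalerDr scalerA mulrC -scalerA -(hu K) -?(hv K); try by lia.
  rewrite scaler_sumr -big_split; apply: eq_bigr => j _ /=.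
  by rewrite !linearP /= scalerDr addrACA.
have [A1 QA1] := Q_nil x v; have [A2 hA2] := hm_nil (inh x) v.
pose A := (A1 + A2)%N; pose s := latform G x t.
have QA (l : nat) : (A <= l)%N -> Q x l v = 0 by move=> ?; apply: QA1; lia.
have hA (i : nat) : (A <= i)%N -> hm (inh x) i v = 0 by move=> ?; apply: hA2;
  lia.
have QhA (i l : nat) : (A <= l)%N -> Q x l (hm (inh x) i v) = 0.
  by move=> Al; rewrite -hm_Q0 // QA ?linear0.
exists (A + A + `|n| + `|s|).+1 => -[//|K] KA.
pose g (k : int) (w : V) := P x (k - n - s) (S x w).
(* The factor - n splits as (l - n - s) + s - l: the creation part, the zero mode and the
   annihilation part of x(z) contribute one summand each. *)
transitivity (\sum_(l < A) (l%:Z - n - s)%:~R *: g l (Q x l v) +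
    (s%:~R *: \sum_(l < A) g l (Q x l v) +
     \sum_(l < A) (- l%:~R) *: g l (Q x l v))); last first.
  rewrite scaler_sumr -!big_split /= (E_homogeneous _ tv QA) scaler_sumr.
  apply: eq_bigr => l _; rewrite -!scalerDl /g; congr (_ *: P x _ _).
    by rewrite !intrD !intrN; ring.
  by rewrite /s; lia.
rewrite big_split /=; congr (_ + _).
  under eq_bigr => j _ do rewrite (E_homogeneous _ tv QA) linear_sum.
  rewrite exchange_big; apply: eq_bigr => l _ /=; rewrite /g.
  rewrite (expseq_rec (P_expseq x) (n := K.+1)); last by have := ltn_ord l; lia.
  by apply: eq_bigr => j _; congr (hm _ _ (P x _ _)); rewrite /s; lia.
rewrite big_ord_recl; congr (_ + _).
  rewrite tv linearZ /= hform_inh (E_homogeneous _ tv QA); congr (_ *: _).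
  by apply: eq_bigr => l _; rewrite /g /s; congr (P x _ _); lia.
transitivity (\sum_(i < K) \sum_(k < A + A.+1) g k
  (Q x (k%:Z - i.+1%:Z) (hm (inh x) i.+1 v))).
  apply: eq_bigr => i _; rewrite lift0.
  rewrite (E_homogeneous _ (homogeneous_hm _ _ tv) (QhA i.+1)).
  case: (leqP A i.+1) => Ai.
    by rewrite hA // !big1 // => k _; rewrite /g !linear0.
  pose f (l : int) := g (l + i.+1%:Z) (Q x l (hm (inh x) i.+1 v)).
  transitivity (\sum_(k < A + A.+1) f (k%:Z - i.+1%:Z)); last first.
    by apply: eq_bigr => k _; rewrite /f subrK.
  rewrite sumr_ord_shift; last first.
    move=> l l0; rewrite /f.
    case: l l0 => [l|l] l0; last by rewrite (expseq_lt0 (Q_expseq x)) // /g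
      !linear0.
    by rewrite QhA ?/g ?linear0 //; lia.
  rewrite [RHS](@sumr_ord_widen _ (fun l => f l%:Z) A) ?leq_addr //.
    by apply: eq_bigr => l _; rewrite /f /g /s; congr (P x _ _); lia.
  by move=> l Al; rewrite /f QhA // /g !linear0.
rewrite exchange_big /=.
transitivity (\sum_(k < A + A.+1) - (k%:Z)%:~R *: g k%:Z (Q x k%:Z v)).
  apply: eq_bigr => k _; rewrite /g -!linear_sum -linearZ -linearZ /=;
    congr (P x _ (S x _)).
  rewrite scaleNr (expseq_rec (Q_expseq x) (n := K)); last by have := ltn_ord k;
    lia.
  rewrite -sumrN; apply: eq_bigr => i _ /=; by rewrite opprK hm_Q0.
apply: (sumr_ord_widen (f := fun k : nat => - (k%:Z)%:~R *: g k%:Z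
  (Q x k%:Z v))).
  by lia.
by move=> k Ak; rewrite QA // /g !linear0.
Qed.

(* the modes of :a(z) E^x(z): *)
Definition cur (a : H) (x : L) : int -> V -> V := nprod (hm a) (E x).

(** A sum of infinite support is 0 by convention, so finiteness has to be shown: [hm a j] kills v
    for large j, and [E x (n + j)] does for large n + j. *)
Lemma cur_fin a x v : exists K0 : nat, forall (K : nat) (n : int),
  (K0 <= K)%N -> K0%:Z <= K%:Z + n ->
  cur a x n v = \sum_(j < K) (hm a (- j%:Z - 1) (E x (n + j%:Z) v)
                              + E x (n - j%:Z - 1) (hm a j%:Z v)).
Proof.
have [A1 EA1] := E_nil x v; have [A2 hA2] := hm_nil a v.
exists (A1 + A2)%N => K n KA Kn; rewrite /cur /nprod !(@fsum_nat _ _ K)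
  ?big_split //.
  by move=> j Kj; rewrite hA2 ?linear0 //; lia.
by move=> j Kj; rewrite EA1 ?linear0 //; lia.
Qed.

Lemma cur_is_linear a x n : linear (cur a x n).
Proof.
move=> c u v; have [Ku hu] := cur_fin a x u; have [Kv hv] := cur_fin a x v.
have [Kw hw] := cur_fin a x (c *: u + v).
pose K := (Ku + Kv + Kw + `|n|)%N.
rewrite (hu K) ?(hv K) ?(hw K); try by rewrite /K; lia.
rewrite scaler_sumr -big_split; apply: eq_bigr => j _ /=.
by rewrite !linearP /= scalerDr addrACA.
Qed.

HB.instance Definition _ a x n :=
  GRing.isLinear.Build F V V *:%R (cur a x n) (cur_is_linear a x n).

(** The middle term is the contraction of b with E^x, the last one the contraction of b with a. *)
Lemma hm_cur b p a x n v :
  hm b p (cur a x n v) = cur a x n (hm b p v)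
    + (b | inh x) *: cur a x (n + p) v
    + (p%:~R * (b | a)) *: E x (n + p - 1) v.
Proof.
have [K1 hK1] := cur_fin a x v; have [K2 hK2] := cur_fin a x (hm b p v).
pose K := (K1 + K2 + `|n| + `|p|).+1.
rewrite !(hK1 K) ?(hK2 K); try by rewrite /K; lia.
(* At most one j contributes to the contraction of b with a: the creation mode j = p - 1 for p > 0,
   the annihilation mode j = - p for p < 0. *)
pose d (j : nat) := (p%:~R * (b | a) *+ (p == j.+1)) *: E x (n + j%:Z) v
  + (p%:~R * (b | a) *+ (p == - j%:Z)) *: E x (n - j%:Z - 1) v.
have -> : (p%:~R * (b | a)) *: E x (n + p - 1) v = \sum_(j < K) d j.
  case: p @K @d {hK2} => [[|p]|p] K d.
  - rewrite mul0r scale0r big1 // => j _.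
    by rewrite /d !mul0r !mul0rn !scale0r addr0.
  - have pK : (p < K)%N by rewrite /K; lia.
    have npj (j : nat) : (p.+1%:Z == - j%:Z) = false by lia.
    rewrite (bigD1 (Ordinal pK)) //= big1 ?addr0 => [|j].
      by rewrite /d npj eqxx mulr0n scale0r addr0; congr (_ *: E x _ v); lia.
    rewrite -val_eqE /= /d npj eqz_nat eqSS eq_sym => /negbTE ->.
    by rewrite !mulr0n !scale0r addr0.
  have pK : (p.+1 < K)%N by rewrite /K; lia.
  rewrite (bigD1 (Ordinal pK)) //= big1 ?addr0 => [|j].
    by rewrite /d NegzE eqxx mulr0n scale0r add0r; congr (_ *: E x _ v); lia.
  rewrite -val_eqE /= /d NegzE eqr_opp eqz_nat eq_sym => /negbTE ->.
  by rewrite !mulr0n !scale0r addr0.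
rewrite linear_sum scaler_sumr -!big_split; apply: eq_bigr => j _ /=.
rewrite linearD (hm_comm b a p) !(hm_E b p) (hm_comm b a p) !linearD !linearZ /=
  /d.
rewrite (_ : - (- j%:Z - 1) = j.+1); last by lia.
rewrite (_ : n + p + j%:Z = n + j%:Z + p); last by lia.
rewrite (_ : n + p - j%:Z - 1 = n - j%:Z - 1 + p); last by lia.
by rewrite [LHS](AC (3*3) ((1*4)*(2*6)*(3*5))).
Qed.

Lemma E_hm a x m p v :
  E x m (hm a p v) = hm a p (E x m v) - (a | inh x) *: E x (m + p) v.
Proof. by rewrite hm_E addrK. Qed.

(** * Commutators of normally ordered products *)

Section Product.
Variables x y : L.
Hypotheses (xy0 : latform G x y = 0) (exy : eps x y = eps y x).

(** E^x passes E^y freely and meets only a. Each contraction replaces a mode of a by a mode of E^x,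
    and the results add up to the sum of [E_fusion]. *)
Lemma E_cur a m n v :
  E x m (cur a y n v) =
  cur a y n (E x m v) - ((a | inh x) * eps x y) *: E (x + y) (m + n) v.
Proof.
have [K1 hK1] := cur_fin a y v; have [K2 hK2] := cur_fin a y (E x m v).
have [K3 hK3] := E_fusion v xy0 exy.
pose K := (K1 + K2 + K3 + `|n| + `|m|)%N.
rewrite (hK1 K) ?(hK2 K); try by rewrite /K; lia.
rewrite -scalerA -(hK3 K); try by rewrite /K; lia.
rewrite linear_sum -scaleNr scaler_sumr -big_split; apply: eq_bigr => j _ /=.
rewrite linearD (E_hm a x m) !(E_E xy0 exy m) (E_hm a x m) linearB
  [E y _ (_ *: _)]linearZ /=.
rewrite (_ : m + (- j%:Z - 1) = m - j%:Z - 1); last by lia.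
by rewrite scaleNr scalerDr opprD [LHS](AC (2*2) ((1*3)*(2*4))).
Qed.

(* Partial sums of sum_(s in Z) (s + 1) E^x_(m+s) E^y_(n-2-s), the terms with
   s >= 0 and those with s < 0 being collected separately. *)
Definition pole_sum (m n : int) (K : nat) (v : V) : V :=
  \sum_(s < K) (s.+1%:R *: E y (n - s%:Z - 2) (E x (m + s%:Z) v)
                - s%:R *: E x (m - s%:Z - 1) (E y (n + s%:Z - 1) v)).

(** The normal product of E^x with :a E^y: becomes :a E^(x+y): once a is moved outside. The
    contractions of a with E^x met on the way depend on i + j only, and their sum is [pole_sum]. *)
Lemma E_cur_normal_product a m n v : exists K0, forall K : nat, (K0 <= K)%N ->
  \sum_(j < K) (E x (m - j%:Z - 1) (cur a y (n + j%:Z) v)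
                + cur a y (n - j%:Z - 1) (E x (m + j%:Z) v)) =
  eps x y *: cur a (x + y) (m + n) v + (a | inh x) *: pole_sum m n K v.
Proof.
have [A1 ExA] := E_nil x v; have [A2 EyA] := E_nil y v.
have [A3 hA] := hm_nil a v; have [K1 fusv] := E_fusion v xy0 exy.
pose fusion_at (i K0 : nat) := forall (K : nat) (m n : int),
  K0%:Z <= K%:Z + m -> K0%:Z <= K%:Z + n ->
  \sum_(j < K) (E x (m - j%:Z - 1) (E y (n + j%:Z) (hm a i v))
                + E y (n - j%:Z - 1) (E x (m + j%:Z) (hm a i v)))
  = eps x y *: E (x + y) (m + n) (hm a i v).
have [K3 fush] : exists T, forall K, (T <= K)%N ->
    forall i, (i < A3)%N -> fusion_at i K.
  apply: finite_eventually => i; have [K0 hK0] := E_fusion (hm a i%:Z v) xy0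
    exy.
  by exists K0 => K KK0 K' m' n' Km Kn; apply: hK0; lia.
exists (A1 + A2 + A3 + K1 + K3 + `|m| + `|n|).+1 => K hK.
(* Two truncations are needed: [K] for the outer product, and a later [K'] for the inner one, which
   has to serve all the vectors [E x (m + j) v] with j < K. *)
pose cur_at (j K0 : nat) := forall (K : nat) (p : int),
  (K0 <= K)%N -> K0%:Z <= K%:Z + p ->
  cur a y p (E x (m + j%:Z) v) =
  \sum_(i < K) (hm a (- i%:Z - 1) (E y (p + i%:Z) (E x (m + j%:Z) v))
                + E y (p - i%:Z - 1) (hm a i%:Z (E x (m + j%:Z) v))).
have [T curT] : exists T, forall K', (T <= K')%N ->
    forall j, (j < K)%N -> cur_at j K'.
  apply: finite_eventually => j; have [K0 hK0] := cur_fin a y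
    (E x (m + j%:Z) v).
  by exists K0 => K' KK0 K'' p Kp Kp'; apply: hK0; lia.
have [Tv curv] := cur_fin a y v; have [Tw curw] := cur_fin a (x + y) v.
pose K' := (T + Tv + Tw + K + A3 + `|m| + `|n|).+1.
pose h (s : nat) := E y (n - s%:Z - 2) (E x (m + s%:Z) v)
  - E x (m - s%:Z - 2) (E y (n + s%:Z) v).
have step (j : 'I_K) (i : 'I_K') :
    E x (m - j%:Z - 1) (hm a (- i%:Z - 1) (E y (n + j%:Z + i%:Z) v)
                        + E y (n + j%:Z - i%:Z - 1) (hm a i v))
    + (hm a (- i%:Z - 1) (E y (n - j%:Z - 1 + i%:Z) (E x (m + j%:Z) v))
       + E y (n - j%:Z - 1 - i%:Z - 1) (hm a i (E x (m + j%:Z) v)))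
  = hm a (- i%:Z - 1) (E x (m - j%:Z - 1) (E y (n + i%:Z + j%:Z) v)
                       + E y (n + i%:Z - j%:Z - 1) (E x (m + j%:Z) v))
    + (E x (m - j%:Z - 1) (E y (n - i%:Z - 1 + j%:Z) (hm a i v))
       + E y (n - i%:Z - 1 - j%:Z - 1) (E x (m + j%:Z) (hm a i v)))
    + (a | inh x) *: h (i + j)%N.
  rewrite linearD (E_hm a x (m - j%:Z - 1)) (hm_E a i x) !linearD linearZ /= /h.
  rewrite (_ : n + i%:Z + j%:Z = n + j%:Z + i%:Z); last by lia.
  rewrite (_ : n - j%:Z - 1 + i%:Z = n + i%:Z - j%:Z - 1); last by lia.
  rewrite (_ : n - i%:Z - 1 + j%:Z = n + j%:Z - i%:Z - 1); last by lia.
  rewrite (_ : n - j%:Z - 1 - i%:Z - 1 = n - i%:Z - 1 - j%:Z - 1); last by lia.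
  rewrite (_ : m - j%:Z - 1 + (- i%:Z - 1) = m - (i + j)%N%:Z - 2); last by lia.
  rewrite (_ : n + j%:Z + i%:Z = n + (i + j)%N%:Z); last by lia.
  rewrite (_ : m + j%:Z + i%:Z = m + (i + j)%N%:Z); last by lia.
  rewrite (_ : n - i%:Z - 1 - j%:Z - 1 = n - (i + j)%N%:Z - 2); last by lia.
  by rewrite [E y _ (_ *: _)]linearZ /= [LHS](AC (3*(1*2)) ((1*4)*(3*5)*(6*2))).
transitivity (\sum_(i < K') (eps x y *:
  (hm a (- i%:Z - 1) (E (x + y) (m + n + i%:Z) v)
      + E (x + y) (m + n - i%:Z - 1) (hm a i v))
    + (a | inh x) *: \sum_(j < K) h (i + j)%N)).
  under eq_bigr => j _.
    have jK := ltn_ord j.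
    rewrite (curv K') ?(curT T _ j _ K') //; try by rewrite /K'; lia.
    rewrite linear_sum -big_split /=.
    under eq_bigr => i _ do rewrite linearD -linearD step.
    over.
  rewrite exchange_big; apply: eq_bigr => i _ /=;
    rewrite big_split /= -scaler_sumr.
  congr (_ + _); rewrite big_split scalerDr /=; congr (_ + _).
    rewrite -linear_sum (fusv K); try by lia.
    by rewrite linearZ /=; congr (_ *: hm _ _ (E _ _ _)); lia.
  case: (ltnP i A3) => iA.
    rewrite (fush _ (leqnn _)) //; try by lia.
    by congr (_ *: E _ _ _); lia.
  by rewrite hA // !linear0 big1 // => j _; rewrite !linear0 addr0.
rewrite big_split -!scaler_sumr /= (curw K'); try by rewrite /K'; lia.
have KK' : (K <= K')%N by rewrite /K'; lia.
have h0 s : (K <= s)%N -> h s = 0.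
  move=> Ks; rewrite /h ExA; last by lia.
  rewrite EyA; last by lia.
  by rewrite !linear0 addr0.
congr (_ + _ *: _); rewrite exchange_big (sumr_antidiagonal KK' h0).
rewrite /pole_sum sumrB /h; under eq_bigr => s _ do rewrite mulrnBl.
rewrite sumrB; congr (_ - _); first by apply: eq_bigr => s _;
  rewrite scaler_nat.
(* In [pole_sum] the terms of negative index are numbered one step later. The shift pushes out the
   last term, which vanishes, and brings in a first one of weight 0. *)
case: K hK {K' KK' h0 step curT h cur_at} => // K hK.
rewrite big_ord_recr [RHS]big_ord_recl /= scale0r add0r EyA; last by lia.
rewrite linear0 mul0rn addr0; apply: eq_bigr => s _.
by rewrite -scaler_nat; congr (_ *: E x _ (E y _ v)); rewrite /bump; lia.
Qed.

(* Take a = y in E_cur_normal_product: the coefficient (y|x) of pole_sum is 0,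
   and since :y(z) E^y(z): is the derivative of E^y(z), the left-hand side is
   pole_sum minus n times the sum of E_fusion. *)
Lemma pole_sumE m n v : exists K0, forall K : nat, (K0 <= K)%N ->
  pole_sum m n K v =
  eps x y *: (cur (inh y) (x + y) (m + n) v + n%:~R *: E (x + y) (m + n - 1) v).
Proof.
have curE p w : cur (inh y) y p w = - p%:~R *: E y (p - 1) w.
  have [K1 hK1] := E_derivative y p w; have [K2 hK2] := cur_fin (inh y) y w.
  by rewrite (hK2 (K1 + K2 + `|p|)%N) ?hK1 //; lia.
have [K1 hK1] := E_cur_normal_product (inh y) m n v.
have [K2 hK2] := E_fusion v xy0 exy.
exists (K1 + K2 + `|m| + `|n|).+1 => K hK.
rewrite scalerDr; have := hK1 K; rewrite hform_inh Gsym xy0 scale0r addr0.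
move=> <-; last by lia.
rewrite scalerA mulrC -scalerA (_ : m + n - 1 = m + (n - 1)); last by lia.
rewrite -(hK2 K); try by lia.
rewrite scaler_sumr -big_split; apply: eq_bigr => j _ /=.
rewrite !curE linearZ /=.
rewrite (_ : n + j%:Z - 1 = n - 1 + j%:Z); last by lia.
rewrite (_ : n - j%:Z - 1 - 1 = n - j%:Z - 2); last by lia.
rewrite (_ : n - 1 - j%:Z - 1 = n - j%:Z - 2); last by lia.
rewrite [E x _ (_ *: _)]linearZ /= scalerDr [RHS](AC (2*2) ((2*4)*(1*3))) /=.
rewrite -!scalerDl scalerN -scaleNr; congr (_ *: _ + _ *: _).
  rewrite -[j.+1%:R]/(j.+1%:Z%:~R) -intrN -intrD; congr _%:~R; lia.
rewrite -[j%:R]/(j%:Z%:~R) -!intrN -intrD; congr _%:~R; lia.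
Qed.

(** Both factors of :a E^x: are moved past :c E^y: by [E_cur] and [hm_cur]. The leftovers form :a
    E^(x+y):, the left-hand side of [E_cur_normal_product] for c, and a [pole_sum] with coefficient
    - (a|c). *)
Lemma cur_comm a c m n v :
  cur a x m (cur c y n v) - cur c y n (cur a x m v) =
  eps x y *: ((a | inh y) *: cur c (x + y) (m + n) v
    - (c | inh x) *: cur a (x + y) (m + n) v
    - ((a | c) - (a | inh y) * (c | inh x)) *:
      (cur (inh y) (x + y) (m + n) v + n%:~R *: E (x + y) (m + n - 1) v)).
Proof.
have [K1 fv] := cur_fin a x v; have [K2 ffv] := cur_fin a x (cur c y n v).
have [K3 fz] := cur_fin a (x + y) v.
have [K4 DD] := E_cur_normal_product c m n v; have [K5 Z] := pole_sumE m n v.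
have [K6 EyK] := E_nil y v.
pose K := (K1 + K2 + K3 + K4 + K5 + K6 + `|m| + `|n|).+1.
set w := _ + n%:~R *: _.
(* Rewritten with [pole_sum], the right-hand side becomes a sum over the same j < K as the left-hand
   side, and the identity then holds term by term. *)
have -> : eps x y *: ((a | inh y) *: cur c (x + y) (m + n) v
    - (c | inh x) *: cur a (x + y) (m + n) v
    - ((a | c) - (a | inh y) * (c | inh x)) *: w) =
  - ((c | inh x) * eps x y) *: cur a (x + y) (m + n) v
  + ((a | inh y) *: (eps x y *: cur c (x + y) (m + n) v
                     + (c | inh x) *: pole_sum m n K v)
     - (a | c) *: pole_sum m n K v).
  rewrite (Z K); last by rewrite /K; lia.
  rewrite -/w; move: (cur c _ _ v) (cur a _ _ v) => Xc Xa {fz DD Z}.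
  transitivity ((eps x y * (a | inh y)) *: Xc - (eps x y * (c | inh x)) *: Xa
      + (((a | inh y) * (c | inh x) - (a | c)) * eps x y) *: w).
    rewrite !scalerBr !scalerA -!scaleNr; congr (_ + _ + _ *: _); ring.
  rewrite [in RHS]scalerDr !scalerA -!scaleNr [RHS](AC (1*3) ((2*1)*(3*4))) /=.
  rewrite -[in RHS]scalerDl.
  by congr (_ *: _ + _ *: _ + _ *: _); ring.
rewrite -(DD K); last by rewrite /K; lia.
rewrite (ffv K) ?(fv K) ?(fz K); try by rewrite /K; lia.
apply/eqP; rewrite subr_eq; apply/eqP.
rewrite [cur c y n (\sum_(i < _) _)]linear_sum /pole_sum !scaler_sumr -sumrN.
rewrite -!big_split /=.
apply: eq_bigr => j _.
pose C1 := E x (m - j%:Z - 1) (cur c y (n + j%:Z) v).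
pose C2 := cur c y (n - j%:Z - 1) (E x (m + j%:Z) v).
pose H1 := hm a (- j%:Z - 1) (E (x + y) (m + n + j%:Z) v).
pose H2 := E (x + y) (m + n - j%:Z - 1) (hm a j%:Z v).
pose Y1 := E y (n - j%:Z - 2) (E x (m + j%:Z) v).
pose Y2 := E x (m - j%:Z - 1) (E y (n + j%:Z - 1) v).
pose q := (c | inh x) * eps x y.
have -> : hm a (- j%:Z - 1) (E x (m + j%:Z) (cur c y n v)) =
    cur c y n (hm a (- j%:Z - 1) (E x (m + j%:Z) v)) + (a | inh y) *: C2
    - (j.+1%:R * (a | c)) *: Y1 - q *: H1.
  rewrite E_cur linearB [hm a _ (_ *: _)]linearZ hm_cur /=.
  have -> : (- j%:Z - 1)%:~R = - j.+1%:R :> F.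
    by rewrite -[j.+1%:R]/(j.+1%:Z%:~R) -intrN; congr _%:~R; lia.
  rewrite mulNr scaleNr.
  rewrite (_ : n + (- j%:Z - 1) = n - j%:Z - 1); last by lia.
  rewrite (_ : n - j%:Z - 1 - 1 = n - j%:Z - 2); last by lia.
  by rewrite (_ : m + j%:Z + n = m + n + j%:Z); last by lia.
have -> : E x (m - j%:Z - 1) (hm a j (cur c y n v)) =
    cur c y n (E x (m - j%:Z - 1) (hm a j v)) - q *: H2 + (a | inh y) *: C1
    + (j%:R * (a | c)) *: Y2.
  rewrite hm_cur 2!linearD 2!linearZ /= E_cur.
  by rewrite (_ : m - j%:Z - 1 + n = m + n - j%:Z - 1); last by lia.
rewrite -/C1 -/C2 -/H1 -/H2 -/Y1 -/Y2 [cur c y n (_ + _)]linearD /= -/q.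
move: C1 C2 H1 H2 Y1 Y2 (cur _ _ _ _) (cur _ _ _ _) => C1 C2 H1 H2 Y1 Y2 D1 D2.
rewrite scalerBr 2!scalerDr !scalerA !scaleNr opprB ![(a | c) * _]mulrC.
by rewrite [LHS](AC (4*4) (((4*6)*((7*2)*(8*3)))*(1*5))).
Qed.

End Product.

(** * The affine relations *)

Hypothesis hmZ : forall k a m v, hm (k *: a) m v = k *: hm a m v.
Hypothesis S0 : forall v, S 0 v = v.

(** For x + y = 0 the fused field is the identity, which produces the central term of the affine
    relations. *)
Lemma E0 n v : E 0 n v = (if n == -1 then v else 0).
Proof.
have h0 m w : hm (inh 0) m w = 0 by rewrite inh0 -(scale0r (0 : H)) hmZ scale0r.
have P0 k w : P 0 k w = if k == 0 then w else 0.
  case: (ltrP k 0) => [k0|k0]; first by rewrite (expseq_lt0 (P_expseq 0)) //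
    lt_eqF.
  case: eqVneq => [->|nk]; first exact: (expseq0 (P_expseq 0)).
  have kF : k%:~R != 0 :> F by rewrite intr_eq0_pchar0.
  apply: (scalerI kF); rewrite (expseq_rec (P_expseq 0) (n := `|k|)) ?big1
    ?scaler0 //.
  by lia.
have Q0 k w : Q 0 k w = if k == 0 then w else 0.
  case: (ltrP k 0) => [k0|k0]; first by rewrite (expseq_lt0 (Q_expseq 0)) //
    lt_eqF.
  case: eqVneq => [->|nk]; first exact: (expseq0 (Q_expseq 0)).
  have kF : k%:~R != 0 :> F by rewrite intr_eq0_pchar0.
  apply: (scalerI kF); rewrite (expseq_rec (Q_expseq 0) (n := `|k|)) ?big1
    ?scaler0 //.
    by move=> i _; rewrite /= h0 oppr0.
  by lia.
elim/homogeneous_ind: v => [t v tv|a u v hu hv]; last first.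
  by rewrite linearP /= hu hv; case: ifP => // _; rewrite scaler0 addr0.
rewrite (E_homogeneous (K := 1) n tv) => [|l l0]; last first.
  by rewrite Q0 gt_eqF //; lia.
rewrite big_ord1 /= P0 S0 Q0 eqxx /latform mul0mx mul0mx mxE subr0.
by rewrite (_ : (_ == _) = (n == -1)) //; lia.
Qed.

Lemma cur0 a n v : cur a 0 n v = hm a n v.
Proof.
have [K1 hK1] := cur_fin a 0 v; pose K := (K1 + `|n|).+1.
rewrite (hK1 K); try by rewrite /K; lia.
under eq_bigr => j _ do rewrite !E0.
case: n @K => [n|n] K.
  have nK : (n < K)%N by rewrite /K; lia.
  rewrite (bigD1 (Ordinal nK)) //= big1 ?addr0 => [|j].
    by rewrite linear0 add0r (_ : (_ - _ - _ == _) = true) //; lia.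
  rewrite -val_eqE /= => jn; rewrite linear0 add0r.
  by rewrite (_ : (_ - _ - _ == _) = false) //; lia.
have nK : (n < K)%N by rewrite /K; lia.
have neg (j : nat) : (Negz n - j%:Z - 1 == -1) = false by lia.
rewrite (bigD1 (Ordinal nK)) //= big1 ?addr0 => [|j].
  rewrite neg addr0 (_ : (_ + _ == _) = true); last by lia.
  by rewrite (_ : - _ - _ = Negz n) //; lia.
rewrite -val_eqE /= => jn; rewrite neg addr0.
by rewrite (_ : (_ + _ == _) = false) ?linear0 //; lia.
Qed.

Variable vac : V.
Hypothesis vac_neq0 : vac != 0.
Hypothesis vac_hm : forall a (n : nat), hm a n vac = 0.
Hypothesis nondeg : forall a : H, (forall b, (a | b) = 0) -> a = 0.

(** Applied to c_(-1) vac, the mode (a - b)_(1) returns (a - b|c) vac; nondegeneracy concludes. *)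
Lemma hm_inj a b : (forall n v, hm a n v = hm b n v) -> a = b.
Proof.
move=> ab; apply/eqP; rewrite -subr_eq0; apply/eqP/nondeg => c.
have : hm (a - b) 1 (hm c (-1) vac) = 0.
  by rewrite hmD -scaleN1r hmZ scaleN1r ab subrr.
rewrite hm_comm vac_hm linear0 add0r opprK eqxx mul1r mulr1n => /eqP.
by rewrite scaler_eq0 (negbTE vac_neq0) orbF => /eqP.
Qed.

Lemma E_vac x : E x (-1) vac = S x vac.
Proof.
have vac0 : homogeneous 0 vac.
  by move=> a; rewrite vac_hm inh0 hform0r scale0r.
rewrite (E_homogeneous (K := 1) _ vac0) => [|l l0]; last first.
  by apply: Q_annihilated => // a n; rewrite vac_hm.
rewrite big_ord1 /= (expseq0 (Q_expseq x)) /latform linear0 mulmx0 mxE subr0.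
by rewrite (_ : _ - _ - _ = 0) // (expseq0 (P_expseq x)).
Qed.

Variable delta : L.
Hypothesis delta_null : latform G delta delta = 0.
Hypotheses (eps_dN : eps delta (- delta) = 1)
  (eps_Nd : eps (- delta) delta = 1).
Hypothesis r_gt0 : (0 < r)%N.

Let delta_nullN : latform G delta (- delta) = 0.
Proof. by rewrite latformNr delta_null oppr0. Qed.

Let deltaN_null : latform G (- delta) (- delta) = 0.
Proof. by rewrite latformNl delta_nullN oppr0. Qed.

(** By the normalization of the cocycle, [S (- delta)] inverts [S delta]. *)
Let E_delta_vac : E delta (-1) vac != 0.
Proof.
rewrite E_vac; apply/eqP => Sv0; move/eqP: vac_neq0; apply.
by rewrite -[LHS]S0 -(addNr delta) -[S _ _]scale1r -eps_Nd -S_S Sv0 linear0.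
Qed.

Let E_deltaN_vac : E (- delta) (-1) vac != 0.
Proof.
rewrite E_vac; apply/eqP => Sv0; move/eqP: vac_neq0; apply.
by rewrite -[LHS]S0 -(addrN delta) -[S _ _]scale1r -eps_dN -S_S Sv0 linear0.
Qed.

Lemma hmN a m v : hm (- a) m v = - hm a m v.
Proof. by rewrite -(scaleN1r a) hmZ scaleN1r. Qed.

Section Embedding.
Variables (k : F) (al be ga : H).
Let d := inh delta.
Let e := cur al delta.
Let f := cur ga (- delta).
Let kappa := (al | ga) + (al | d) * (ga | d).
Let rho := kappa *: d - (ga | d) *: al - (al | d) *: ga.

Let dE : inh (- delta) = - d. Proof. exact: inhN. Qed.

Lemma cur_ef m n v : e m (f n v) - f n (e m v) =
  hm rho (m + n) v + (m%:~R * (m == - n)%:R * kappa) *: v.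
Proof.
rewrite /e /f cur_comm // ?eps_dN ?eps_Nd //.
rewrite addrN !cur0 E0 scale1r dE hformNr mulNr opprK -/d -/kappa.
rewrite !hmD !hmN !hmZ scaleNr scalerDr scalerN !opprD opprK.
rewrite [LHS](AC (2*2) ((3*2*1)*4)) /=; congr (_ + _).
(* The identity field has only its mode -1, which occurs for m + n = 0; there - n kappa = m
   kappa. *)
rewrite (_ : (_ - 1 == -1) = (m == - n)); last by lia.
case: eqP => [->|_]; last by rewrite !scaler0 oppr0 mulr0 mul0r scale0r.
by rewrite scalerA -scaleNr mulr1 intrN mulNr mulrC.
Qed.

Lemma cur_ee m n v : (al | al) = (al | d) ^+ 2 -> e m (e n v) - e n (e m v) = 0.
Proof.
by move=> ad; rewrite /e cur_comm // ad -expr2 !subrr scale0r subr0 scaler0.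
Qed.

Lemma cur_ff m n v : (ga | ga) = (ga | d) ^+ 2 -> f m (f n v) - f n (f m v) = 0.
Proof.
move=> ad; rewrite /f cur_comm // ad dE hformNr -expr2 sqrrN.
by rewrite !subrr scale0r subr0 scaler0.
Qed.

Lemma hm_e m n v : hm be m (e n v) - e n (hm be m v) =
  (be | d) *: e (m + n) v + (m%:~R * (be | al)) *: E delta (m + n - 1) v.
Proof. by rewrite hm_cur [n + m]addrC [LHS](ACl ((2*3)*(1*4))) /= subrr addr0.
Qed.

Lemma hm_f m n v : hm be m (f n v) - f n (hm be m v) =
  - (be | d) *: f (m + n) v + (m%:~R * (be | ga)) *: E (- delta) (m + n - 1) v.
Proof. by rewrite hm_cur dE hformNr [n + m]addrC [LHS](ACl ((2*3)*(1*4))) /=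
  subrr addr0. Qed.

Definition sl2_relations (e h f : int -> V -> V) := forall (m n : int) v,
  [/\ e m (f n v) - f n (e m v) = h (m + n) v + (m%:~R * (m == - n)%:R * k) *:
    v,
      h m (e n v) - e n (h m v) = 2 *: e (m + n) v,
      h m (f n v) - f n (h m v) = -2 *: f (m + n) v,
      h m (h n v) - h n (h m v) = (m%:~R * (m == - n)%:R * (2 * k)) *: v &
      e m (e n v) - e n (e m v) = 0 /\ f m (f n v) - f n (f m v) = 0].

(** The equations make [rho] orthogonal to [al] and [ga] and give (rho|d) = 2, so the last terms of
    [hm_e] and [hm_f] vanish. Pairing [be] with the expression of [rho] then yields (be|be) = 2
    k. *)
Lemma sl2_relations_sufficient :
  be = rho -> kappa = k -> (al | d) * (ga | d) = -1 ->
  (al | al) = (al | d) ^+ 2 -> (ga | ga) = (ga | d) ^+ 2 ->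
  sl2_relations e (hm be) f.
Proof.
move=> beE kE ac aa cc m n v.
have dd : (d | d) = 0 by rewrite hform_inh delta_null.
have ag : (al | ga) = k + 1 by rewrite -kE /kappa ac subrK.
have rhoE c : (rho | c) = k * (d | c) - (ga | d) * (al | c) - (al | d) *
  (ga | c).
  by rewrite /rho kE !hformDl !hformNl !hformZl.
have bd : (be | d) = 2.
  rewrite beE rhoE dd mulr0 sub0r [(ga | d) * _]mulrC ac; ring.
have ba : (be | al) = 0.
  rewrite beE rhoE (hformC Gsym d) (hformC Gsym ga al) aa ag.
  have -> : (ga | d) * (al | d) ^+ 2 = (al | d) * ((al | d) * (ga | d)) by ring.
  rewrite ac; ring.
have bg : (be | ga) = 0.
  rewrite beE rhoE (hformC Gsym d) cc ag.
  have -> : (al | d) * (ga | d) ^+ 2 = (ga | d) * ((al | d) * (ga | d)) by ring.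
  rewrite ac; ring.
have bb : (be | be) = 2 * k.
  rewrite [in X in (_ | X)]beE (hformC Gsym) rhoE.
  by rewrite !(hformC Gsym _ be) bd ba bg; ring.
split; [| | | |split].
- by rewrite cur_ef kE beE.
- by rewrite hm_e bd ba mulr0 scale0r addr0.
- by rewrite hm_f bd bg mulr0 scale0r addr0.
- by rewrite hm_comm bb addrAC subrr add0r -mulrnAr -mulr_natr; congr (_ *: _);
  ring.
- exact: cur_ee.
exact: cur_ff.
Qed.

Hypothesis span4 : forall w : H, exists p q s t,
  w = p *: al + q *: be + s *: ga + t *: d.

Lemma sl2_relations_necessary : sl2_relations e (hm be) f ->
  [/\ be = rho, kappa = k, (al | d) * (ga | d) = -1,
      (al | al) = (al | d) ^+ 2 & (ga | ga) = (ga | d) ^+ 2].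
Proof.
move=> rel.
have two0 : 2 != 0 :> F by rewrite ((pcharf0P F).1 F0).
have dd : (d | d) = 0 by rewrite hform_inh delta_null.
(* On the vacuum, with m = 1 and n = -1, the Heisenberg modes vanish and only the central terms
   remain. *)
have kE : kappa = k.
  have [+ _ _ _ _] := rel 1 (-1) vac; rewrite cur_ef addrN !vac_hm !add0r.
  by rewrite opprK eqxx !mul1r => /eqP; rewrite -subr_eq0 -scalerBl scaler_eq0
    (negbTE vac_neq0) orbF subr_eq0 => /eqP.
have beE : be = rho.
  apply: hm_inj => n v; have [+ _ _ _ _] := rel n 0 v.
  by rewrite cur_ef kE addr0 => /addIr ->.
have rhoE c : (be | c) = k * (d | c) - (ga | d) * (al | c) - (al | d) *
  (ga | c).
  by rewrite beE /rho kE !hformDl !hformNl !hformZl.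
(* The mode b_(1) contracts with [al] and leaves (b|al) times the nonzero vector
   [E delta (-1) vac]. *)
have al_eq0 : (forall n v, e n v = 0) -> al = 0.
  move=> e0; apply: nondeg => b; have := hm_cur b 1 al delta (-1) vac.
  rewrite -/e !e0 linear0 scaler0 !add0r mul1r => /esym/eqP.
  by rewrite scaler_eq0 (negbTE E_delta_vac) orbF (hformC Gsym) => /eqP.
have ga_eq0 : (forall n v, f n v = 0) -> ga = 0.
  move=> f0; apply: nondeg => b; have := hm_cur b 1 ga (- delta) (-1) vac.
  rewrite -/f !f0 linear0 scaler0 !add0r mul1r => /esym/eqP.
  by rewrite scaler_eq0 (negbTE E_deltaN_vac) orbF (hformC Gsym) => /eqP.
(* Otherwise e = 0, hence [al], then [be] and then [ga] vanish. By [span4] the space is spanned by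
   [d], which is isotropic and so 0 by nondegeneracy, contradicting [r_gt0]. *)
have bd : (be | d) = 2.
  apply/eqP/negPn/negP => bd.
  have al0 : al = 0.
    apply: al_eq0 => n v; have [_ + _ _ _] := rel 0 n v.
    rewrite hm_e mul0r scale0r addr0 add0r => /eqP.
    by rewrite -subr_eq0 -scalerBl scaler_eq0 subr_eq0 (negbTE bd) => /eqP.
  have be0 : be = 0.
    by rewrite beE /rho /kappa al0 !hform0l mul0r addr0 !scale0r scaler0 !subr0.
  have ga0 : ga = 0.
    apply: ga_eq0 => n v; have [_ _ + _ _] := rel 0 n v.
    rewrite hm_f be0 !hform0l mulr0 scale0r oppr0 scale0r addr0 add0r =>
      /esym/eqP.
    by rewrite scaler_eq0 oppr_eq0 (negbTE two0) => /eqP.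
  have span1 w : exists t, w = t *: d.
    have [p [q [s [t ->]]]] := span4 w; exists t.
    by rewrite al0 be0 ga0 !scaler0 !add0r.
  have d0 : d = 0.
    by apply: nondeg => w; have [t ->] := span1 w; rewrite hformZr dd mulr0.
  have [t /rowP/(_ (Ordinal r_gt0))] := span1 (const_mx 1).
  by rewrite d0 scaler0 !mxE => /eqP; rewrite oner_eq0.
have ba : (be | al) = 0.
  have [_ + _ _ _] := rel 1 (-1) vac; rewrite hm_e bd => /eqP.
  rewrite -subr_eq0 addrAC subrr add0r mul1r scaler_eq0 => /orP[/eqP //|].
  by rewrite addrN add0r (negbTE E_delta_vac).
have bg : (be | ga) = 0.
  have [_ _ + _ _] := rel 1 (-1) vac; rewrite hm_f bd => /eqP.
  rewrite -subr_eq0 addrAC subrr add0r mul1r scaler_eq0 => /orP[/eqP //|].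
  by rewrite addrN add0r (negbTE E_deltaN_vac).
have ac : (al | d) * (ga | d) = -1.
  have : 2 * ((al | d) * (ga | d) + 1) = 0.
    transitivity (2 - (k * 0 - (ga | d) * (al | d) - (al | d) * (ga | d)));
      first by ring.
    by rewrite -{1}bd rhoE dd subrr.
  by move/eqP; rewrite mulf_eq0 (negbTE two0) /= addr_eq0 => /eqP.
have ag : (al | ga) = k + 1 by rewrite -kE /kappa ac subrK.
split=> //.
  (* Multiplied by (al|d), the equation (be|al) = 0 loses k and becomes the norm condition, as
     (al|d)(ga|d) = -1. *)
  have := rhoE al; rewrite ba (hformC Gsym d) (hformC Gsym ga al) ag.
  move=> /(congr1 ( *%R (al | d))); rewrite mulr0.
  have -> : (al | d) * (k * (al | d) - (ga | d) * (al | al) - (al | d) *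
    (k + 1)) =
    - (al | d) ^+ 2 - ((al | d) * (ga | d)) * (al | al) by ring.
  by rewrite ac mulN1r opprK addrC => /eqP; rewrite eq_sym subr_eq0 => /eqP.
have := rhoE ga; rewrite bg (hformC Gsym d) ag.
move=> /(congr1 ( *%R (ga | d))); rewrite mulr0.
have -> : (ga | d) * (k * (ga | d) - (ga | d) * (k + 1) - (al | d) * (ga | ga))
  =
  - (ga | d) ^+ 2 - ((al | d) * (ga | d)) * (ga | ga) by ring.
by rewrite ac mulN1r opprK addrC => /eqP; rewrite eq_sym subr_eq0 => /eqP.
Qed.

Definition sl2_modes (e h f : int -> V -> V) (a : 'M[F]_2) (n : int) (v : V) :=
  a 0 1 *: e n v + a 0 0 *: h n v + a 1 0 *: f n v.

Definition sl2_embedding (e h f : int -> V -> V) :=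
  forall a b : 'M[F]_2, \tr a = 0 -> \tr b = 0 ->
  forall (m n : int) (v : V),
    let X := sl2_modes e h f in
    X a m (X b n v) - X b n (X a m v) =
    X (a *m b - b *m a) (m + n) v
    + (m%:~R * (m == - n)%:R * \tr (a *m b) * k) *: v.

(** Both sides are bilinear in the two trace-free matrices, so it suffices to compare them on the
    basis e, h, f. *)
Lemma sl2_embeddingP (e' h' f' : int -> {linear V -> V}) :
  sl2_embedding e' h' f' <-> sl2_relations e' h' f'.
Proof.
have o1 : lift ord0 ord0 = 1 :> 'I_2 by apply/val_inj.
have mx2 (a b : 'M[F]_2) i j : (a *m b) i j = a i 0 * b 0 j + a i 1 * b 1 j.
  by rewrite mxE !big_ord_recl big_ord0 addr0 o1.
have tr2 (a : 'M[F]_2) : \tr a = a 0 0 + a 1 1.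
  by rewrite /mxtrace !big_ord_recl big_ord0 addr0 o1.
pose X := sl2_modes e' h' f'.
have X_sub (a : 'M[F]_2) m v (T : V -> V) : linear T ->
    X a m (T v) - T (X a m v) =
    a 0 1 *: (e' m (T v) - T (e' m v)) + a 0 0 *: (h' m (T v) - T (h' m v))
    + a 1 0 *: (f' m (T v) - T (f' m v)).
  move=> linT; pose T' := HB.pack_for {linear V -> V} T
    (GRing.isLinear.Build F V V *:%R T linT).
  rewrite -[T]/(T' : V -> V) /X /sl2_modes !linearD !linearZ /=.
  by rewrite [RHS](AC (2*2*2) ((1*3*5)*(2*4*6))).
have X_linear b n : linear (X b n).
  move=> c u v; rewrite /X /sl2_modes !linearP /= !scalerDr.
  by rewrite [LHS](AC (2*2*2) ((1*3*5)*(2*4*6))).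
have bracket a b m n v : X a m (X b n v) - X b n (X a m v) =
    a 0 1 *: (b 0 1 *: (e' m (e' n v) - e' n (e' m v))
            + b 0 0 *: (e' m (h' n v) - h' n (e' m v))
            + b 1 0 *: (e' m (f' n v) - f' n (e' m v)))
    + a 0 0 *: (b 0 1 *: (h' m (e' n v) - e' n (h' m v))
            + b 0 0 *: (h' m (h' n v) - h' n (h' m v))
            + b 1 0 *: (h' m (f' n v) - f' n (h' m v)))
    + a 1 0 *: (b 0 1 *: (f' m (e' n v) - e' n (f' m v))
            + b 0 0 *: (f' m (h' n v) - h' n (f' m v))
            + b 1 0 *: (f' m (f' n v) - f' n (f' m v))).
  rewrite (X_sub _ _ _ _ (X_linear b n)).
  have sub_X (T : {linear V -> V}) :
    T (X b n v) - X b n (T v) = b 0 1 *: (T (e' n v) - e' n (T v))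
      + b 0 0 *: (T (h' n v) - h' n (T v)) + b 1 0 *: (T (f' n v) - f' n (T v)).
    rewrite -[LHS]opprB (X_sub _ _ _ _ (@linearP _ _ _ _ T)) !opprD -!scalerN.
    by rewrite !opprB.
  by rewrite !sub_X.
have comm_coef (a b : 'M[F]_2) : \tr a = 0 -> \tr b = 0 ->
    [/\ (a *m b - b *m a) 0 1 = 2 * (a 0 0 * b 0 1 - a 0 1 * b 0 0),
        (a *m b - b *m a) 0 0 = a 0 1 * b 1 0 - a 1 0 * b 0 1,
        (a *m b - b *m a) 1 0 = 2 * (a 1 0 * b 0 0 - a 0 0 * b 1 0) &
        \tr (a *m b) = 2 * (a 0 0 * b 0 0) + a 0 1 * b 1 0 + a 1 0 * b 0 1].
  rewrite !tr2 => /eqP; rewrite addrC addr_eq0 => /eqP a11 /eqP.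
  rewrite addrC addr_eq0 => /eqP b11.
  have subE (A B : 'M[F]_2) i j : (A - B) i j = A i j - B i j by rewrite !mxE.
  by split; rewrite ?subE !mx2 ?a11 ?b11; ring.
split=> [emb|rel].
  (* The matrix p h + q e + s f. *)
  pose M (p q s : F) : 'M[F]_2 := \matrix_(i, j)
    (if i == 0 then (if j == 0 then p else q) else (if j == 0 then s else - p)).
  have trM p q s : \tr (M p q s) = 0 by rewrite tr2 !mxE /= addrN.
  have ME p q s : ((M p q s 0 0 = p) * (M p q s 0 1 = q)) * (M p q s 1 0 = s).
    by rewrite !mxE.
  move=> m n v.
  have rel p q s p' q' s' : _ = _ :=
    etrans (esym (bracket _ _ _ _ _))
      (emb _ _ (trM p q s) (trM p' q' s') m n v).
  have coefE p q s p' q' s' := comm_coef _ _ (trM p q s) (trM p' q' s').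
  have simp := (scale0r, scale1r, scaler0, add0r, addr0, mul0r, mulr0, mul1r,
    mulr1, subr0, sub0r, oppr0, ME).
  rewrite /sl2_modes in rel.
  split.
  - have := rel 0 1 0 0 0 1; have [-> -> -> ->] := coefE 0 1 0 0 0 1.
    by rewrite !simp.
  - have := rel 1 0 0 0 1 0; have [-> -> -> ->] := coefE 1 0 0 0 1 0.
    by rewrite !simp.
  - have := rel 1 0 0 0 0 1; have [-> -> -> ->] := coefE 1 0 0 0 0 1.
    by rewrite !simp mulrN1.
  - have := rel 1 0 0 1 0 0; have [-> -> -> ->] := coefE 1 0 0 1 0 0.
    by rewrite !simp mulrA.
  - have := rel 0 1 0 0 1 0; have [-> -> -> ->] := coefE 0 1 0 0 1 0.
    have := rel 0 0 1 0 0 1; have [-> -> -> ->] := coefE 0 0 1 0 0 1.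
    by rewrite !simp.
move=> a b tra trb m n v; rewrite /= bracket /sl2_modes.
have [-> -> -> ->] := comm_coef a b tra trb.
have [ef he hf hh [ee ff]] := rel m n v; have [fe eh fh _ _] := rel n m v.
rewrite ee ff hh ef he hf.
rewrite -[e' m (h' n v) - _]opprB eh -[f' m (e' n v) - _]opprB fe.
rewrite -[f' m (h' n v) - _]opprB fh.
(* The brackets in reversed order come from the relations with m and n exchanged, under which the
   central term is antisymmetric. *)
have -> : n%:~R * (n == - m)%:R * k = - (m%:~R * (m == - n)%:R * k).
  rewrite -eqr_oppLR eq_sym; case: eqP => [->|_];
    last by rewrite !mulr0 !mul0r oppr0.
  by rewrite intrN !mulNr opprK.
rewrite [n + m]addrC; move: (e' _ v) (h' _ v) (f' _ v) => A B C.
move: (m%:~R * _) => J.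
rewrite !scaler0 add0r addr0 !(opprD, scaleNr, opprK, scalerN, scalerDr).
rewrite !scalerA -!scaleNr.
rewrite [LHS](AC ((1*2)*3*3) ((1*4)*(2*7)*(6*9)*(3*5*8))) /= -!scalerDl.
by congr (_ *: _ + _ *: _ + _ *: _ + _ *: _); ring.
Qed.

(** The relations fix only the product (al|d)(ga|d) = -1; [lambda] is the remaining freedom and
    normalizes the two factors to 1 and -1. *)
Lemma sl2_embedding_iff :
  sl2_embedding e (hm be) f <->
  exists2 lambda : F, lambda != 0 &
    let a := lambda *: al in
    let c := lambda^-1 *: ga in
    [/\ be = k *: d + a - c, (d | d) = 0, (a | c) = k + 1 &
        [/\ (a | a) = 1, (c | c) = 1, (d | a) = 1 & - (d | c) = 1]].
Proof.
have dd : (d | d) = 0 by rewrite hform_inh delta_null.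
apply: (iff_trans (sl2_embeddingP _ _ _)); split=> [/sl2_relations_necessary|].
  move=> [beE kE ac aa cc]; have a0 : (al | d) != 0.
    by apply/eqP => a0; move/eqP: ac; rewrite a0 mul0r eq_sym oppr_eq0 oner_eq0.
  have cE : (ga | d) = - (al | d)^-1.
    by apply: (mulfI a0); rewrite ac mulrN divff.
  exists (al | d)^-1; first by rewrite invr_eq0.
  rewrite /= invrK; split=> //.
  - by rewrite beE /rho kE cE scaleNr opprK.
  - rewrite hformZl hformZr mulrA mulVf // mul1r.
    by rewrite -kE /kappa ac subrK.
  split; rewrite ?hformZl ?hformZr ?(hformC Gsym d).
  - by rewrite aa; field.
  - by rewrite cc cE; field.
  - by rewrite mulVf.
  by rewrite cE mulrN opprK divff.
move=> [l l0 [beE _ ac [aa cc da dc]]]; move: beE ac aa cc da dc => /= beE.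
rewrite !(hformZl, hformZr) !(hformC Gsym d) mulrA divff // mul1r => ag aa cc da
  dc.
have adE : (al | d) = l^-1 by apply: (mulfI l0); rewrite da divff.
have cdE : (ga | d) = - l.
  by rewrite -[LHS]mul1r -(divff l0) -mulrA -[X in l * X]opprK dc mulrN1.
have ac1 : (al | d) * (ga | d) = -1 by rewrite adE cdE mulrN mulVf.
have kE : kappa = k by rewrite /kappa ag ac1 addrK.
apply: sl2_relations_sufficient => //.
- by rewrite beE /rho kE adE cdE scaleNr opprK.
- rewrite adE -[LHS]mul1r -(mulVf l0) -[LHS]mul1r -(mulVf l0).
  have -> : l^-1 * l * (l^-1 * l * (al | al)) = l^-1 ^+ 2 *
    (l * (l * (al | al))).
    by field.
  by rewrite aa mulr1.
rewrite cdE sqrrN -[LHS]mul1r -(mulfV l0) -[LHS]mul1r -(mulfV l0).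
have -> : l / l * (l / l * (ga | ga)) = l ^+ 2 * (l^-1 * (l^-1 * (ga | ga))).
  by field.
by rewrite cc mulr1.
Qed.

End Embedding.

End VertexOperators.

(** * The lattice vertex algebra *)

HB.lock Definition zeromode (F : fieldType) (r : nat) (G : 'M[int]_r)
    (a : 'rV[F]_r) : VL F r -> VL F r :=
  linext (fun b => hform G a (inh F b.1) *: bvec F b).

HB.lock Definition translation (F : fieldType) (r : nat)
    (eps : 'rV[int]_r -> 'rV[int]_r -> F) (x : 'rV[int]_r) : VL F r -> VL F r :=
  linext (fun b => eps x b.1 *: bvec F (x + b.1, b.2)).

Section LatticeFock.
Variables (F : fieldType) (r : nat) (G : 'M[int]_r).
Variable eps : 'rV[int]_r -> 'rV[int]_r -> F.
Local Notation V := (VL F r).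
Local Notation basis := (VLbasis r).
Local Notation H := 'rV[F]_r.
Local Notation L := 'rV[int]_r.
Local Notation bvec := (@bvec F r).
Local Notation mulvar := (@mulvar F r).
Local Notation dervar := (@dervar F r).
Local Notation zeromode := (@zeromode F r G).
Local Notation translation := (@translation F r eps).
Local Notation "( a | b )" := (hform G a b).

Fact zeromode_is_linear a : linear (zeromode a).
Proof. by rewrite zeromode.unlock; exact: linext_is_linear. Qed.

Fact translation_is_linear x : linear (translation x).
Proof. by rewrite translation.unlock; exact: linext_is_linear. Qed.

HB.instance Definition _ a :=
  GRing.isLinear.Build F V V *:%R (zeromode a) (zeromode_is_linear a).

HB.instance Definition _ x :=
  GRing.isLinear.Build F V V *:%R (translation x) (translation_is_linear x).

Lemma zeromodeU a b : zeromode a (bvec b) = (a | inh F b.1) *: bvec b.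
Proof. by rewrite zeromode.unlock linextU. Qed.

Lemma translationU x b : translation x (bvec b) = eps x b.1 *: bvec
  (x + b.1, b.2).
Proof. by rewrite translation.unlock linextU. Qed.

Lemma zeromodeC a b v : zeromode a (zeromode b v) = zeromode b (zeromode a v).
Proof.
elim/VL_ind: v => [c|c u v hu hv]; last by rewrite !linearP /= hu hv.
rewrite (zeromodeU b) (zeromodeU a) !linearZ /= (zeromodeU b) (zeromodeU a).
by rewrite !scalerA mulrC.
Qed.

Lemma zeromode_mulvar a q v : zeromode a (mulvar q v) = mulvar q (zeromode a v).
Proof.
elim/VL_ind: v => [b|c u v hu hv]; last by rewrite !linearP /= hu hv.
by rewrite zeromodeU linearZ /= !mulvarU zeromodeU.
Qed.

Lemma zeromode_dervar a q v : zeromode a (dervar q v) = dervar q (zeromode a v).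
Proof.
elim/VL_ind: v => [b|c u v hu hv]; last by rewrite !linearP /= hu hv.
by rewrite zeromodeU linearZ /= !dervarU linearZ /= zeromodeU !scalerA mulrC.
Qed.

Lemma mulvar_translation q x v :
  mulvar q (translation x v) = translation x (mulvar q v).
Proof.
elim/VL_ind: v => [b|c u v hu hv]; last by rewrite !linearP /= hu hv.
by rewrite translationU linearZ /= !mulvarU translationU.
Qed.

Lemma dervar_translation q x v :
  dervar q (translation x v) = translation x (dervar q v).
Proof.
elim/VL_ind: v => [b|c u v hu hv]; last by rewrite !linearP /= hu hv.
by rewrite translationU linearZ /= !dervarU [translation x (_ *: _)]linearZ /=
  translationU !scalerA mulrC.
Qed.

Lemma zeromode_translation a x v : zeromode a (translation x v) =
  translation x (zeromode a v) + (a | inh F x) *: translation x v.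
Proof.
elim/VL_ind: v => [b|c u v hu hv]; last first.
  by rewrite !linearP /= hu hv scalerDr addrACA.
rewrite translationU linearZ /= !zeromodeU [translation x (_ *: _)]linearZ /=.
by rewrite translationU inhD hformDr !scalerA -scalerDl -mulrDl mulrC addrC.
Qed.

Lemma translationM x y v : lattice_cocycle G eps ->
  translation x (translation y v) = eps x y *: translation (x + y) v.
Proof.
move=> [_ _ cocycle _].
elim/VL_ind: v => [b|c u v hu hv]; last first.
  by rewrite !linearP /= hu hv.
rewrite (translationU y) linearZ /= (translationU x) (translationU (x + y)) /=.
by rewrite !scalerA (addrA x y) cocycle mulrC.
Qed.

Lemma translation0 v : lattice_cocycle G eps -> translation 0 v = v.
Proof.
move=> [_ eps0 _ _]; elim/VL_ind: v => [b|c u v hu hv].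
  by rewrite translationU add0r (eps0 b.1).2 scale1r -surjective_pairing.
by rewrite linearP /= hu hv.
Qed.

(** Serves local nilpotency: it is clear on the vectors e^x and survives multiplication by one
    variable. *)
Lemma VL_generated (Pr : V -> Prop) :
  (forall x, Pr (bvec (x, onecm _))) ->
  (forall q v, Pr v -> Pr (mulvar q v)) ->
  (forall a u v, Pr u -> Pr v -> Pr (a *: u + v)) -> forall v, Pr v.
Proof.
move=> P1 PX PD; apply: VL_ind => // -[x m].
have [n] := ubnP (mdeg m); elim: n m => // n IH m mn.
have [/eqP|] := eqVneq (mdeg m) 0%N.
  by rewrite mdeg_eq0 => /eqP ->; exact: P1.
rewrite mdeg_eq0 => m1.
have [q mq] : exists q, m q != 0%N.
  apply: contrapT => /forallNP m0; move/eqP: m1; apply.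
  by apply/eqP/cmP => q; rewrite onecmE; move/negP/negPn/eqP: (m0 q).
rewrite -(divcmK mq) -[X in Pr (bvec X)]/((x, divcm m (ucm q)).1, _) -mulvarU.
apply: PX; apply: IH; rewrite -ltnS (leq_trans _ mn) // ltnS.
have -> : mdeg m = (mdeg (divcm m (ucm q))).+1.
  by rewrite -[in LHS](divcmK mq) mdegM mdegU addn1.
by [].
Qed.

End LatticeFock.

(** * Heisenberg modes on V_L *)

HB.lock Definition hmode (F : fieldType) (r : nat) (G : 'M[int]_r)
    (a : 'rV[F]_r) (m : int) : VL F r -> VL F r :=
  heis_op G (fun q => @mulvar F r q : {linear VL F r -> VL F r})
    (fun q => @dervar F r q : {linear VL F r -> VL F r})
    (fun a => @zeromode F r G a : {linear VL F r -> VL F r}) a m.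

Section LatticeModes.
Variables (F : fieldType) (r : nat) (G : 'M[int]_r).
Variable eps : 'rV[int]_r -> 'rV[int]_r -> F.
Local Notation V := (VL F r).
Local Notation basis := (VLbasis r).
Local Notation H := 'rV[F]_r.
Local Notation L := 'rV[int]_r.
Local Notation bvec := (@bvec F r).
Local Notation hmode := (@hmode F r G).
Local Notation translation := (@translation F r eps).
Local Notation "( a | b )" := (hform G a b).

Fact hmode_is_linear a m : linear (hmode a m).
Proof. by rewrite hmode.unlock; exact: heis_op_is_linear. Qed.

HB.instance Definition _ a m :=
  GRing.isLinear.Build F V V *:%R (hmode a m) (hmode_is_linear a m).

Lemma heisE : heis G = hmode :> (H -> int -> V -> V).
Proof.
apply/funext => a; apply/funext => m; apply/funext => v; rewrite hmode.unlock.
case: m => [[|n]|n] /=.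
- elim/VL_ind: v => [b|c u v hu hv]; last by rewrite !linearP /= hu hv.
  by rewrite zeromodeU /heis linextU bvec.unlock.
- exact: heis_posE.
exact: heis_negE.
Qed.

Lemma hmodeD a b m v : hmode (a + b) m v = hmode a m v + hmode b m v.
Proof.
rewrite hmode.unlock; case: m => [[|n]|n].
- elim/VL_ind: v => [c|c u v hu hv].
    by rewrite /= !zeromodeU hformDl scalerDl.
  by rewrite /= in hu hv *; rewrite !linearP /= hu hv scalerDr addrACA.
- rewrite /= -big_split; apply: eq_bigr => i _ /=.
  by rewrite hformDl mulrDr scalerDl.
rewrite /= -big_split; apply: eq_bigr => i _ /=.
by rewrite mxE scalerDl.
Qed.

Lemma hmodeZ k a m v : hmode (k *: a) m v = k *: hmode a m v.
Proof.
rewrite hmode.unlock; case: m => [[|n]|n].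
- elim/VL_ind: v => [c|c u v hu hv].
    by rewrite /= !zeromodeU hformZl scalerA.
  by rewrite /= in hu hv *; rewrite !linearP /= hu hv !scalerA mulrC.
- rewrite /= scaler_sumr; apply: eq_bigr => i _ /=.
  by rewrite hformZl mulrCA scalerA.
rewrite /= scaler_sumr; apply: eq_bigr => i _ /=.
by rewrite mxE scalerA.
Qed.

Lemma hmode_translation a m x v : hmode a m (translation x v) =
  translation x (hmode a m v) + ((a | inh F x) *+ (m == 0)) *: translation x v.
Proof.
rewrite hmode.unlock; case: m => [[|n]|n].
- exact: zeromode_translation.
- rewrite scale0r addr0 /= linear_sum; apply: eq_bigr => i _ /=.
  by rewrite dervar_translation linearZ.
rewrite scale0r addr0 /= linear_sum; apply: eq_bigr => i _ /=.
by rewrite mulvar_translation linearZ.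
Qed.

Lemma mulvar_hmode q v : mulvar q v = hmode (delta_mx 0 q.1) (Negz q.2) v.
Proof.
rewrite hmode.unlock /= (bigD1 q.1) //= big1 ?addr0 => [|i iq].
  by rewrite mxE !eqxx scale1r -surjective_pairing.
by rewrite mxE (negbTE iq) andbF scale0r.
Qed.

Lemma hmode_vac a x (n : nat) : hmode a n.+1 (bvec (x, onecm _)) = 0.
Proof.
rewrite hmode.unlock /= big1 // => i _.
by rewrite dervarU onecmE scale0r scaler0.
Qed.

Lemma hmode0 a b : hmode a 0 (bvec b) = (a | inh F b.1) *: bvec b.
Proof. by rewrite hmode.unlock /= zeromodeU. Qed.

Hypothesis Gsym : forall x y, latform G x y = latform G y x.

Lemma hmode_comm a b m n v : hmode a m (hmode b n v) =
  hmode b n (hmode a m v) + (m%:~R * (a | b) *+ (m == - n)) *: v.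
Proof.
rewrite hmode.unlock; apply: heis_op_comm => //.
- exact: mulvarC.
- exact: dervarC.
- exact: dervar_mulvar.
- exact: zeromodeC.
- exact: zeromode_mulvar.
exact: zeromode_dervar.
Qed.

Lemma hmode_nil a v :
  exists K : nat, forall n : nat, (K <= n)%N -> hmode a n v = 0.
Proof.
elim/VL_generated: v => [x|q v [K hK]|c u v [Ku hu] [Kv hv]].
- by exists 1%N => -[//|n] _; exact: hmode_vac.
(* The variable [q] contracts with the mode q.2 + 1 only, so the bound lies beyond it. *)
- exists (K + q.2.+2)%N => n Kn; rewrite mulvar_hmode hmode_comm hK;
  last by lia.
  by rewrite linear0 add0r (_ : (_ == _) = false) ?scale0r //; lia.
exists (Ku + Kv)%N => n Kn; rewrite linearP /= hu ?hv ?scaler0 ?addr0 //; lia.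
Qed.

End LatticeModes.

Lemma scaled_comm (F : fieldType) (V : lmodType F) (f g : {linear V -> V})
    (a b : F) v :
  f (g v) = g (f v) -> a *: f (b *: g v) = b *: g (a *: f v).
Proof. by move=> fg; rewrite !linearZ /= fg !scalerA mulrC. Qed.

(** This lemma and the next two hold by conversion and identify the notions of the statement with
    the abstract ones. *)
Lemma opseries_expE (F : fieldType) (r : nat) (A : nat -> VL F r -> VL F r) :
  opseries_exp A = ser_exp A.
Proof. by []. Qed.

Lemma normal_productE (F : fieldType) (r : nat) (A B : int -> VL F r -> VL F r)
  :
  normal_product A B = nprod A B.
Proof. by []. Qed.

Lemma affine_sl2_embeddingE (F : fieldType) (r : nat) (k : F)
    (e h f : int -> VL F r -> VL F r) :
  affine_sl2_embedding k e h f = sl2_embedding k e h f.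
Proof. by []. Qed.

HB.lock Definition creation_term (F : fieldType) (r : nat) (G : 'M[int]_r)
    (x : 'rV[int]_r) (n : nat) (v : VL F r) : VL F r :=
  if n is 0%N then 0 else n%:R^-1 *: hmode G (inh F x) (- n%:Z) v.

HB.lock Definition annihilation_term (F : fieldType) (r : nat) (G : 'M[int]_r)
    (x : 'rV[int]_r) (n : nat) (v : VL F r) : VL F r :=
  if n is 0%N then 0 else - n%:R^-1 *: hmode G (inh F x) n%:Z v.

HB.lock Definition creation (F : fieldType) (r : nat) (G : 'M[int]_r)
    (x : 'rV[int]_r) (k : int) : VL F r -> VL F r :=
  ser_ext (ser_exp (creation_term G x)) k.

HB.lock Definition annihilation (F : fieldType) (r : nat) (G : 'M[int]_r)
    (x : 'rV[int]_r) (k : int) : VL F r -> VL F r :=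
  ser_ext (ser_exp (annihilation_term G x)) k.

HB.lock Definition vertexop (F : fieldType) (r : nat) (G : 'M[int]_r)
    (eps : 'rV[int]_r -> 'rV[int]_r -> F) (x : 'rV[int]_r) (n : int) :
    VL F r -> VL F r := expfield G eps x n.

(** * Exponentials and vertex operators on V_L *)

Section LatticeVertexOperators.
Variables (F : fieldType) (r : nat) (G : 'M[int]_r).
Variable eps : 'rV[int]_r -> 'rV[int]_r -> F.
Hypothesis F0 : [pchar F] =i pred0.
Hypothesis Gsym : forall x y, latform G x y = latform G y x.
Local Notation V := (VL F r).
Local Notation H := 'rV[F]_r.
Local Notation L := 'rV[int]_r.
Local Notation bvec := (@bvec F r).
Local Notation hmode := (@hmode F r G).
Local Notation translation := (@translation F r eps).
Local Notation creation_term := (@creation_term F r G).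
Local Notation annihilation_term := (@annihilation_term F r G).
Local Notation creation := (@creation F r G).
Local Notation annihilation := (@annihilation F r G).
Local Notation vertexop := (@vertexop F r G eps).
Local Notation inh := (inh F).

Lemma creation_term0 x w : creation_term x 0 w = 0.
Proof. by rewrite creation_term.unlock. Qed.

Lemma creation_termS x n w : creation_term x n.+1 w =
  n.+1%:R^-1 *: hmode (inh x) (- n.+1%:Z) w.
Proof. by rewrite creation_term.unlock. Qed.

Fact creation_term_is_linear x n : linear (creation_term x n).
Proof.
rewrite creation_term.unlock.
case: n => [|n] a u v /=; first by rewrite scaler0 addr0.
by rewrite linearP scalerDr !scalerA mulrC.
Qed.

Lemma annihilation_term0 x w : annihilation_term x 0 w = 0.
Proof. by rewrite annihilation_term.unlock. Qed.

Lemma annihilation_termS x n w : annihilation_term x n.+1 w =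
  - n.+1%:R^-1 *: hmode (inh x) n.+1%:Z w.
Proof. by rewrite annihilation_term.unlock. Qed.

Fact annihilation_term_is_linear x n : linear (annihilation_term x n).
Proof.
rewrite annihilation_term.unlock.
case: n => [|n] a u v /=; first by rewrite scaler0 addr0.
by rewrite linearP scalerDr !scalerA mulrC.
Qed.

HB.instance Definition _ x n := GRing.isLinear.Build F V V *:%R
  (creation_term x n) (creation_term_is_linear x n).

HB.instance Definition _ x n := GRing.isLinear.Build F V V *:%R
  (annihilation_term x n) (annihilation_term_is_linear x n).

Lemma creation_termC x i j v : creation_term x i (creation_term x j v) =
  creation_term x j (creation_term x i v).
Proof.
case: i => [|i]; first by rewrite !creation_term0 [RHS]linear0.
case: j => [|j]; first by rewrite !creation_term0 [LHS]linear0.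
rewrite !creation_termS; apply: (@scaled_comm F V (hmode _ _) (hmode _ _)).
by rewrite /= hmode_comm // (_ : _ == _ = false) ?scale0r ?addr0 //; lia.
Qed.

Lemma annihilation_termC x i j v :
  annihilation_term x i (annihilation_term x j v) =
  annihilation_term x j (annihilation_term x i v).
Proof.
case: i => [|i]; first by rewrite !annihilation_term0 [RHS]linear0.
case: j => [|j]; first by rewrite !annihilation_term0 [LHS]linear0.
rewrite !annihilation_termS; apply: (@scaled_comm F V (hmode _ _) (hmode _ _)).
by rewrite /= hmode_comm // (_ : _ == _ = false) ?scale0r ?addr0 //; lia.
Qed.

Fact creation_is_linear x k : linear (creation x k).
Proof.
rewrite creation.unlock.
exact: (@ser_exp_is_linear F V (fun n => creation_term x n) (creation_term0 x)).
Qed.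

Fact annihilation_is_linear x k : linear (annihilation x k).
Proof.
rewrite annihilation.unlock.
exact: (@ser_exp_is_linear F V (fun n => annihilation_term x n)
  (annihilation_term0 x)).
Qed.

Fact vertexop_is_linear x n : linear (vertexop x n).
Proof. by rewrite vertexop.unlock; exact: linext_is_linear. Qed.

HB.instance Definition _ x k := GRing.isLinear.Build F V V *:%R
  (creation x k) (creation_is_linear x k).

HB.instance Definition _ x k := GRing.isLinear.Build F V V *:%R
  (annihilation x k) (annihilation_is_linear x k).

HB.instance Definition _ x n := GRing.isLinear.Build F V V *:%R
  (vertexop x n) (vertexop_is_linear x n).

Lemma creation_expseq x :
  expseq (fun i => hmode (inh x) (- i.+1%:Z)) (creation x).
Proof.
have := @ser_exp_expseq F V F0 (fun n => creation_term x n)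
  (creation_term0 x) (creation_termC x).
rewrite creation.unlock; congr expseq; apply/funext => i; apply/funext => v /=.
by rewrite creation_termS scalerA divff ?scale1r // ((pcharf0P F).1 F0).
Qed.

Lemma annihilation_expseq x :
  expseq (fun i => (-%R \o hmode (inh x) i.+1%:Z : {linear V -> V}))
    (annihilation x).
Proof.
have := @ser_exp_expseq F V F0 (fun n => annihilation_term x n)
  (annihilation_term0 x) (annihilation_termC x).
rewrite annihilation.unlock; congr expseq; apply/funext => i;
  apply/funext => v /=.
by rewrite annihilation_termS scalerA mulrN divff ?scaleN1r //
  ((pcharf0P F).1 F0).
Qed.

Lemma exp_creationE x : exp_creation G x = ser_exp (creation_term x).
Proof. by rewrite /exp_creation opseries_expE heisE creation_term.unlock. Qed.

Lemma exp_annihilationE x : exp_annihilation G x = ser_exp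
  (annihilation_term x).
Proof. by rewrite /exp_annihilation opseries_expE heisE
  annihilation_term.unlock. Qed.

Lemma annihilation_nil x v :
  exists K : nat, forall l : nat, (K <= l)%N -> annihilation x l v = 0.
Proof.
elim/VL_generated: v => [y|q v [K hK]|c u v [Ku hu] [Kv hv]].
- exists 1%N => l l0.
  apply: (Q_annihilated F0 (hmode_comm Gsym) annihilation_expseq) => // a n.
  exact: hmode_vac.
(* The contraction with [q] lowers the degree by q.2 + 1, and the lowered degree must still exceed
   the bound for v. *)
- exists (K + q.2.+1)%N => l Kl; rewrite (mulvar_hmode G).
  have := hm_Q F0 (hmode_comm Gsym) annihilation_expseq (delta_mx 0 q.1) q.2 x l
    v.
  rewrite /= -NegzE (hK l) ?linear0; last by lia.
  rewrite (_ : _ + Negz _ = (l - q.2.+1)%N%:Z); last by lia.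
  by rewrite (hK (l - q.2.+1)%N) ?scaler0 ?addr0 //; lia.
exists (Ku + Kv)%N => n Kn; rewrite linearP /= hu ?hv ?scaler0 ?addr0 //; lia.
Qed.

End LatticeVertexOperators.

Lemma linear_comb (F : fieldType) (V W : lmodType F) (D : {linear V -> W})
    (I : Type) (s : seq I) (c : I -> F) (w : I -> V) :
  D (\sum_(i <- s) c i *: w i) = \sum_(i <- s) c i *: D (w i).
Proof. by rewrite linear_sum; apply: eq_bigr => i _; rewrite linearZ. Qed.

Section LatticeInstance.
Variables (F : fieldType) (r : nat) (G : 'M[int]_r).
Variable eps : 'rV[int]_r -> 'rV[int]_r -> F.
Hypothesis F0 : [pchar F] =i pred0.
Hypothesis Gsym : forall x y, latform G x y = latform G y x.
Local Notation V := (VL F r).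
Local Notation H := 'rV[F]_r.
Local Notation L := 'rV[int]_r.
Local Notation bvec := (@bvec F r).
Local Notation hmode := (@hmode F r G).
Local Notation translation := (@translation F r eps).
Local Notation creation := (@creation F r G).
Local Notation annihilation := (@annihilation F r G).
Local Notation vertexop := (@vertexop F r G eps).
Local Notation inh := (inh F).

Lemma intr_inj_pchar0 (m n : int) : m%:~R = n%:~R :> F -> m = n.
Proof.
move=> mn; apply/eqP; rewrite -subr_eq0 -(intr_eq0_pchar0 F0) intrD intrN mn.
by rewrite subrr.
Qed.

Lemma shiftE x : shift eps x = translation x.
Proof.
by rewrite translation.unlock bvec.unlock.
Qed.

Lemma vertexopU x n b (K : nat) :
  (forall l : nat, (K <= l)%N -> annihilation x l (bvec b) = 0) ->
  vertexop x n (bvec b) = \sum_(l < K)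
    creation x (l%:Z - n - 1 - latform G x b.1)
      (translation x (annihilation x l (bvec b))).
Proof.
move=> AK; rewrite vertexop.unlock /expfield linextU.
pose f (l : nat) := creation x (l%:Z - n - 1 - latform G x b.1)
      (translation x (annihilation x l (bvec b))).
have f0 l : (K <= l)%N -> f l = 0 by move=> Kl; rewrite /f AK // !linear0.
rewrite -[RHS](fsum_nat f0); apply: eq_fsbigr => l _; rewrite /f.
rewrite exp_creationE exp_annihilationE shiftE.
by rewrite creation.unlock annihilation.unlock bvec.unlock.
Qed.

(** Zero modes are diagonal on monomials, so a homogeneous vector involves only monomials with the
    right eigenvalues. *)
Lemma hmode0_coef a (v : V) b : (hmode a 0 v)@_b = hform G a (inh b.1) * v@_b.
Proof.
elim/VL_ind: v => [b'|c u v hu hv].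
  rewrite hmode0 mcoeffZ bvec.unlock mcoeffU.
  by case: (eqVneq b' b) => [->|] //=; rewrite !mulr0n !mulr0.
by rewrite linearP mcoeffD mcoeffZ hu hv [RHS]mulrC mcoeffD mcoeffZ mulrDl;
  ring.
Qed.

Lemma vertexop_homogeneous x t n (K : nat) v :
  homogeneous G hmode t v ->
  (forall l : nat, (K <= l)%N -> annihilation x l v = 0) ->
  vertexop x n v = \sum_(l < K) creation x (l%:Z - n - 1 - latform G x t)
    (translation x (annihilation x l v)).
Proof.
move=> tv AK.
have deg b : v@_b != 0 -> latform G x b.1 = latform G x t.
  move=> vb; apply: intr_inj_pchar0; rewrite -!hform_inh; apply: (mulIf vb).
  by rewrite -hmode0_coef tv mcoeffZ.
(* The bound [K] is known for v but not for its monomials, so the range is enlarged to one that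
   serves all of them. *)
have [K1 hK1] : exists K1 : nat, forall b, b \in enum_fset (msupp v) ->
    forall l : nat, (K1 <= l)%N -> annihilation x l (bvec b) = 0.
  elim: (enum_fset _) => [|b s [K2 hK2]]; first by exists 0%N.
  have [K3 hK3] := annihilation_nil F0 Gsym x (bvec b).
  exists (K2 + K3)%N => c; rewrite inE => /predU1P[-> l Kl|cs l Kl].
    by apply: hK3; lia.
  by apply: hK2 => //; lia.
pose D (l : nat) : {linear V -> V} :=
  creation x (l%:Z - n - 1 - latform G x t) \o
    (translation x \o annihilation x l).
transitivity (\sum_(l < K + K1) D l v); last first.
  apply: (sumr_ord_widen (f := fun l => D l v)) => [|l Kl];
    first exact: leq_addr.
  by rewrite /D /= AK // !linear0.
transitivity (\sum_(b <- msupp v) v@_b *: vertexop x n (bvec b)).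
  by rewrite -linear_comb -VL_decomposition.
transitivity (\sum_(l < K + K1) \sum_(b <- msupp v) v@_b *: D l (bvec b));
  last first.
  by apply: eq_bigr => l _; rewrite -linear_comb -VL_decomposition.
rewrite exchange_big /= big_seq [RHS]big_seq; apply: eq_bigr => b bv.
rewrite (@vertexopU _ _ _ (K + K1)) => [|l Kl]; last by apply: hK1 => //; lia.
rewrite scaler_sumr; apply: eq_bigr => l _.
by rewrite deg // mcoeff_neq0.
Qed.

Lemma lattice_homogeneous_ind (Pr : V -> Prop) :
  (forall t v, homogeneous G hmode t v -> Pr v) ->
  (forall a u v, Pr u -> Pr v -> Pr (a *: u + v)) -> forall v, Pr v.
Proof.
move=> Ph PD; apply: VL_ind => // b; apply: (Ph b.1) => a; exact: hmode0.
Qed.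

(** Nondegeneracy over the integers gives a nonzero determinant, which stays nonzero in
    characteristic 0. *)
Lemma hform_nondegenerate :
  (forall x, (forall y, latform G x y = 0) -> x = 0) ->
  forall a : H, (forall b, hform G a b = 0) -> a = 0.
Proof.
move=> Gnd a ab.
have detG : \det G != 0.
  apply/negP => /det0P[x x0 xG]; move/eqP: x0; apply; apply: Gnd => y.
  by rewrite /latform xG mul0mx mxE.
have GF : (map_mx intr G : 'M[F]_r) \in unitmx.
  by rewrite unitmxE det_map_mx unitfE intr_eq0_pchar0.
have aG : a *m map_mx intr G = 0.
  apply/rowP => i; have := ab (delta_mx 0 i).
  by rewrite /hform trmx_delta -colE !mxE.
by rewrite -(mulmxK GF a) aG mul0mx.
Qed.

End LatticeInstance.

Lemma span4P (F : fieldType) (U : vectType F) (a b c d : U) :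
  <<[:: a; b; c; d]>>%VS = fullv -> forall w, exists p q s t,
  w = p *: a + q *: b + s *: c + t *: d.
Proof.
move=> full w; have := memvf w; rewrite -full !span_cons span_nil addv0.
move=> /memv_addP[_ /vlineP[p ->] [w1 w1M ->]].
case/memv_addP: w1M => _ /vlineP[q ->] [w2 w2M ->].
case/memv_addP: w2M => _ /vlineP[s ->] [_ /vlineP[t ->] ->].
by exists p, q, s, t; rewrite !addrA.
Qed.

(** * The embedding theorem for V_L *)

Section LatticeEmbedding.
Variables (F : fieldType) (r : nat) (G : 'M[int]_r).
Variable eps : 'rV[int]_r -> 'rV[int]_r -> F.
Variable delta : 'rV[int]_r.
Hypothesis F0 : [pchar F] =i pred0.
Hypothesis latG : integral_lattice G.
Hypothesis eps_cocycle : lattice_cocycle G eps.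
Hypothesis delta_null : latform G delta delta = 0.

Let Gsym x y : latform G x y = latform G y x.
Proof. by have [_ ->] := latG. Qed.

Lemma bvec_neq0 b : bvec F b != 0 :> VL F r.
Proof. by rewrite bvec.unlock monalgU_eq0 oner_eq0. Qed.

Lemma expvecE x : expvec F x = bvec F (x, onecm _) :> VL F r.
Proof. by rewrite /expvec bvec.unlock. Qed.

(** No annihilation mode acts on e^(-delta), and (delta|delta) = 0 puts the creation part in degree
    0; only the cocycle value remains. *)
Lemma eps_deltaN :
  expfield G eps delta (-1) (expvec F (- delta)) = vacuum F r ->
  eps delta (- delta) = 1.
Proof.
rewrite /vacuum !expvecE => norm.
pose w := bvec F (- delta, onecm _).
have wN : homogeneous G (fun a m => hmode G a m : {linear VL F r -> VL F r})
  (- delta) w.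
  by move=> a; rewrite /= hmode0.
have wA (l : nat) : (1 <= l)%N -> annihilation G delta l w = 0.
  move=> l0; apply: (Q_annihilated F0 (hmode_comm Gsym)
    (annihilation_expseq F0 Gsym)) => //.
  by move=> a n; exact: hmode_vac.
have e_w : vertexop G eps delta (-1) w = bvec F (0, onecm _).
  by rewrite vertexop.unlock.
move: norm => _.
have := vertexop_homogeneous eps F0 Gsym (-1) wN wA; rewrite e_w.
rewrite big_ord1 /= (expseq0 (annihilation_expseq F0 Gsym delta)).
rewrite latformNr delta_null oppr0 subr0 (_ : 0%:Z - -1 - 1 = 0) //.
rewrite (expseq0 (creation_expseq F0 Gsym delta)) translationU /= addrN => /eqP.
rewrite -subr_eq0 -[X in X - _]scale1r -scalerBl scaler_eq0.
by rewrite (negbTE (bvec_neq0 _)) orbF subr_eq0 => /eqP.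
Qed.

(** All the forms in the exponent of the commutator condition vanish, so its sign is 1. *)
Lemma eps_Ndelta : eps delta (- delta) = 1 -> eps (- delta) delta = 1.
Proof.
move=> eps_dN.
have [_ _ _ ->] := eps_cocycle.
by rewrite eps_dN latformNl delta_null oppr0 mulr0 addr0 mulr1.
Qed.

Theorem lattice_sl2_embedding (k : F) (al be ga : 'rV[F]_r) :
  expfield G eps delta (-1) (expvec F (- delta)) = vacuum F r ->
  <<[:: al; be; ga; inh F delta]>>%VS = fullv ->
  affine_sl2_embedding k
    (normal_product (heis G al) (expfield G eps delta))
    (heis G be)
    (normal_product (heis G ga) (expfield G eps (- delta)))
  <->
  exists2 lambda : F, lambda != 0 &
    let a := lambda *: al in
    let c := lambda^-1 *: ga in
    let d := inh F delta in
    [/\ be = k *: d + a - c,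
        hform G d d = 0,
        hform G a c = k + 1 &
        [/\ hform G a a = 1, hform G c c = 1,
            hform G d a = 1 & - hform G d c = 1]].
Proof.
move=> /eps_deltaN eps_dN /span4P span; have [r0 _ Gnd] := latG.
rewrite heisE !normal_productE affine_sl2_embeddingE.
have -> : expfield G eps = vertexop G eps by rewrite vertexop.unlock.
apply: (@sl2_embedding_iff F r G (VL F r) eps F0 Gsym (@hmode F r G)
  (@hmodeD F r G) (hmode_comm Gsym) (creation G) (annihilation G)
    (translation eps)
  (creation_expseq F0 Gsym) (annihilation_expseq F0 Gsym)
  (@hmode_translation F r G eps) (fun x y v => translationM x y v eps_cocycle)
  (@lattice_homogeneous_ind F r G)
  (vertexop G eps) (@vertexop_homogeneous F r G eps F0 Gsym)
  (@hmode_nil F r G Gsym) (annihilation_nil F0 Gsym) (@hmodeZ F r G)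
  (fun v => translation0 v eps_cocycle) (bvec F (0, onecm _))) => //.
- exact: bvec_neq0.
- move=> a [|n]; last exact: hmode_vac.
  by apply: etrans (hmode0 G a _) _; rewrite inh0 hform0r scale0r.
- exact: hform_nondegenerate.
exact: eps_Ndelta.
Qed.

End LatticeEmbedding.

Theorem theorem2p1 (R : realType) (k : R[i]) (r : nat) (G : 'M[int]_r)
    (eps : 'rV[int]_r -> 'rV[int]_r -> R[i])
    (delta : 'rV[int]_r) (alpha beta gamma : 'rV[R[i]]_r) :
  integral_lattice G ->
  lattice_cocycle G eps ->
  latform G delta delta = 0 ->
  expfield G eps delta (-1) (expvec _ (- delta)) = vacuum _ r ->
  <<[:: alpha; beta; gamma; inh _ delta]>>%VS = fullv ->
  affine_sl2_embedding k
    (normal_product (heis G alpha) (expfield G eps delta))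
    (heis G beta)
    (normal_product (heis G gamma) (expfield G eps (- delta)))
  <->
  exists2 lambda : R[i], lambda != 0 &
    let a := lambda *: alpha in
    let c := lambda^-1 *: gamma in
    let d := inh _ delta in
    [/\ beta = k *: d + a - c,
        hform G d d = 0,
        hform G a c = k + 1 &
        [/\ hform G a a = 1, hform G c c = 1,
            hform G d a = 1 & - hform G d c = 1]].
Proof.
move=> latG cocycle delta_null norm span.
exact: (lattice_sl2_embedding (@pchar_num R[i]) latG cocycle delta_null k norm span).
Qed.
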